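(* Let $r$ be the maximum arity among the relation symbols of $\sigma$ and let $k\ge r$. Then for every pair of $\sigma$-structures $\mathbf{A}$, $\mathbf{B}$ the following are equivalent: (1) $\mathbf{A}\equiv_k\mathbf{B}$; (2) $\hom(\mathbf{X};\mathbf{A})=\hom(\mathbf{X};\mathbf{B})$ for every $\sigma$-structure $\mathbf{X}$ of treewidth less than $k$; (3) $\mathbf{A}$ and $\mathbf{B}$ satisfy the same formulae of the logic $\mathscr{C}^k$; (4) Duplicator has a winning strategy for the bijective $k$-pebble game on $\mathbf{A}$, $\mathbf{B}$.
   Context: A signature $\sigma$ is a finite set of relation symbols with arities $\operatorname{ar}(R)\ge1$; a $\sigma$-structure has finite universe and relations $R^\mathbf{A}\subseteq A^{\operatorname{ar}(R)}$. $\hom(\mathbf{X};\mathbf{A})$ is the number of homomorphisms from $\mathbf{X}$ to $\mathbf{A}$. Constraints: $\mathcal{C}_\mathbf{A}=\{R(\mathbf{a}):R\in\sigma,\mathbf{a}\in R^\mathbf{A}\}$. For a tuple $\mathbf{a}$, $a_i$ is its $i$-th entry, $\{\mathbf{a}\}$ its entry set, $\pi_\mathbf{i}\mathbf{a}=(a_{i_1},\dots,a_{i_n})$ for $\mathbf{i}=(i_1,\dots,i_n)$. Treewidth: a tree decomposition of $\mathbf{X}$ is a tree $G=(V,E)$ with $\beta:V\to\mathcal{P}(X)$ such that each $R(\mathbf{x})\in\mathcal{C}_\mathbf{X}$ has $\{\mathbf{x}\}\subseteq\beta(v)$ for some $v$, and for each $x$ the nodes $v$ with $x\in\beta(v)$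 form a connected subtree; width is $\max_v|\beta(v)|-1$; treewidth is the minimum width. $\mathscr{C}^k$ is first-order logic over $\sigma$ with counting quantifiers $\exists^n x$ (''at least $n$ elements $x$''), restricted to formulae using at most $k$ distinct variables. Bijective $k$-pebble game on $\mathbf{A},\mathbf{B}$: if $|A|\ne|B|$ Spoiler wins. Otherwise there are $k$ pebble pairs $(x_i,y_i)$. In each round Spoiler picks up some pebble $x_i$ and Duplicator the corresponding $y_i$; Duplicator chooses a bijection $f:A\to B$; Spoiler places $x_i$ on some $a\in A$ and $y_i$ is placed on $f(a)$. Duplicator wins the round if the map sending the element under each placed $x_i$ to the element under $y_i$ is a well-defined partial isomorphism between the induced substructures of $\mathbf{A}$ and $\mathbf{B}$; Duplicator has a winning strategy if she can win every round of the (infinite) game. $\equiv_1$: factor graph of $\mathbf{A}$ is the bipartite graph on $A\cup\mathcal{C}_\mathbf{A}$ with edges $\{a,R(\mathbf{a})\}$ for $a\in\{\mathbf{a}\}$ labelled $(\{i:a_i=a\},R)$; $\delta_0^\mathbf{A}(v)$ is one of two fixed symbols according as $v\in A$ or $v\in\mathcal{C}_\mathbf{A}$; $\delta_j^\mathbf{A}(v)=\{\{(\text{label of }\{v,w\},\delta^\mathbf{A}_{j-1}(w)):w\text{ adjacent to }v\}\}$; $\mathbf{A}\equiv_1\mathbf{B}$ iff the multisets of sequences $(\delta_j(v))_{j\ge0}$ over all factor-graph vertices coincide. $\mathbf{A}^{*k}$: universe $\bigcup_{1\le j\le k}A^j\cup\mathcal{C}_\mathbf{A}$, unary relations $T_{j,S}=\{\mathbf{a}\in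 A^j:a_i=a_{i'}\ \forall i,i'\in S\}$ ($j\le k$, $S\subseteq[j]$), $R_S=\{R(\mathbf{a}):\mathbf{a}\in R^\mathbf{A},a_i=a_{i'}\ \forall i,i'\in S\}$, binary $T_{j,\mathbf{i}}=\{(\mathbf{a},\pi_\mathbf{i}\mathbf{a}):\mathbf{a}\in A^j\}$ ($j,j'\le k$, $\mathbf{i}\in[j]^{j'}$), $R_\mathbf{i}=\{(R(\mathbf{a}),\pi_\mathbf{i}\mathbf{a}):\mathbf{a}\in R^\mathbf{A}\}$ ($j\le k$, $\mathbf{i}\in[\operatorname{ar}(R)]^j$). For $k\ge2$, $\mathbf{A}\equiv_k\mathbf{B}$ means $\mathbf{A}^{*k}\equiv_1\mathbf{B}^{*k}$; for $k=1$ it is $\equiv_1$. *)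

(* Defs.v *)
From HB Require Import structures.
From mathcomp Require Import all_boot all_order all_algebra.
Set Implicit Arguments. Unset Strict Implicit. Unset Printing Implicit Defensive.
Import Order.TTheory GRing.Theory Num.Theory.

Record signature := Signature {
  sym :> finType;
  ar : sym -> nat;
  ar_pos : forall R, 0 < ar R }.

Record structure (sg : signature) := MkStructure {
  univ : finType;
  rels : forall R : sym sg, {set {ffun 'I_(ar R) -> univ}} }.
Arguments rels {sg} s R.
Arguments MkStructure {sg univ}.

(* Maximum arity r of the signature (0 if the signature is empty). *)
Definition maxar (sg : signature) : nat := \max_(R : sym sg) ar R.

Definition is_hom sg (X A : structure sg) (h : {ffun univ X -> univ A}) : bool :=
  [forall R : sym sg, forall t : {ffun 'I_(ar R) -> univ X},
     (t \in rels X R) ==> ([ffun i => h (t i)] \in rels A R)].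

Arguments is_hom {sg} X A h.

Definition nhom sg (X A : structure sg) : nat := #|[set h | is_hom X A h]|.

Definition is_tree (V : finType) (e : rel V) : Prop :=
  [/\ 0 < #|V|, symmetric e, irreflexive e,
      (forall x y, connect e x y) &
      (forall p : seq V, uniq p -> 2 < size p -> ~~ cycle e p)].

Definition tree_decomposition sg (X : structure sg) (V : finType) (e : rel V)
    (beta : V -> {set univ X}) : Prop :=
  [/\ is_tree e,
      (forall (R : sym sg) (t : {ffun 'I_(ar R) -> univ X}),
          t \in rels X R -> exists v, forall i, t i \in beta v) &
      (forall (x : univ X) (v w : V), x \in beta v -> x \in beta w ->
          connect [rel a b | [&& e a b, x \in beta a & x \in beta b]] v w)].

Arguments tree_decomposition {sg} X {V} e beta.

(* width = max_v |beta(v)| - 1 (an integer, -1 when all bags are empty) *)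
Definition width (V : finType) (T : finType) (beta : V -> {set T}) : int :=
  ((\max_(v : V) #|beta v|)%:Z - 1)%R.

(* treewidth(X) < k : the minimum width over all tree decompositions is < k,
   i.e. some tree decomposition has width < k. *)
Definition treewidth_lt sg (X : structure sg) (k : nat) : Prop :=
  exists (V : finType) (e : rel V) (beta : V -> {set univ X}),
    tree_decomposition X e beta /\ (width beta < k%:Z)%R.

Inductive formula (sg : signature) (k : nat) : Type :=
| FAtom (R : sym sg) (v : 'I_(ar R) -> 'I_k)
| FEq (x y : 'I_k)
| FNot (p : formula sg k)
| FAnd (p q : formula sg k)
| FOr (p q : formula sg k)
| FExistsN (n : nat) (x : 'I_k) (p : formula sg k).

Fixpoint fv sg k (phi : formula sg k) : {set 'I_k} :=
  match phi with
  | FAtom R v => [set v i | i : 'I_(ar R)]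
  | FEq x y => [set x; y]
  | FNot p => fv p
  | FAnd p q => fv p :|: fv q
  | FOr p q => fv p :|: fv q
  | FExistsN _ x p => fv p :\ x
  end.

Definition upd (T : Type) k (al : 'I_k -> T) (x : 'I_k) (a : T) : 'I_k -> T :=
  fun y => if y == x then a else al y.

Fixpoint sat sg k (A : structure sg) (al : 'I_k -> option (univ A))
    (phi : formula sg k) {struct phi} : bool :=
  match phi with
  | FAtom R v => [exists t : {ffun 'I_(ar R) -> univ A},
                    [forall i, al (v i) == Some (t i)] && (t \in rels A R)]
  | FEq x y => (al x != None) && (al x == al y)
  | FNot p => ~~ sat al p
  | FAnd p q => sat al p && sat al q
  | FOr p q => sat al p || sat al q
  | FExistsN n x p => n <= #|[pred a : univ A | sat (upd al x (Some a)) p]|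
  end.

Arguments sat {sg k} A al phi.

Definition Ck_equiv sg (k : nat) (A B : structure sg) : Prop :=
  forall phi : formula sg k, fv phi = set0 ->
    sat A (fun _ => None) phi = sat B (fun _ => None) phi.

Definition partial_iso sg (A B : structure sg) (p : univ A -> univ B -> bool) : Prop :=
  [/\ (forall a b b', p a b -> p a b' -> b = b'),
      (forall a a' b, p a b -> p a' b -> a = a') &
      (forall (R : sym sg) (t : {ffun 'I_(ar R) -> univ A})
              (u : {ffun 'I_(ar R) -> univ B}),
          (forall i, p (t i) (u i)) -> (t \in rels A R) = (u \in rels B R))].

(* The map given by the pebble placement: x_i on al i, y_i on be i. *)
Definition pebble_map sg (A B : structure sg) k
    (al : 'I_k -> option (univ A)) (be : 'I_k -> option (univ B)) :=
  fun a b => [exists i, (al i == Some a) && (be i == Some b)].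

(* A strategy for Duplicator: given the history of Spoiler's moves
   (pebble picked, element where x_i was placed) in previous rounds and the
   pebble picked in the current round, a map A -> B (required bijective). *)
Definition strategy sg (A B : structure sg) k :=
  seq ('I_k * univ A) -> 'I_k -> univ A -> univ B.

Fixpoint run sg (A B : structure sg) k (st : strategy A B k)
    (past h : seq ('I_k * univ A))
    (al : 'I_k -> option (univ A)) (be : 'I_k -> option (univ B))
    {struct h} : ('I_k -> option (univ A)) * ('I_k -> option (univ B)) :=
  match h with
  | [::] => (al, be)
  | (i, a) :: h' =>
      run st (rcons past (i, a)) h' (upd al i (Some a)) (upd be i (Some (st past i a)))
  end.

Definition winning sg (A B : structure sg) k (st : strategy A B k) : Prop :=
  (forall past i, bijective (st past i)) /\
  (forall h : seq ('I_k * univ A),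
     let pos := run st [::] h (fun _ => None) (fun _ => None) in
     partial_iso (pebble_map pos.1 pos.2)).

Definition dup_wins sg (k : nat) (A B : structure sg) : Prop :=
  #|univ A| = #|univ B| /\ exists st : strategy A B k, winning st.

Definition cdata sg (A : structure sg) : finType :=
  {R : sym sg & {ffun 'I_(ar R) -> univ A}}.
Definition constr sg (A : structure sg) : finType :=
  {c : cdata A | tagged c \in rels A (tag c)}.
Definition fvert sg (A : structure sg) : finType := (univ A + constr A)%type.
Definition label (sg : signature) : finType := {R : sym sg & {set 'I_(ar R)}}.

Definition fadj sg (A : structure sg) (v w : fvert A) : bool :=
  match v, w with
  | inl a, inr c | inr c, inl a => [exists i, tagged (val c) i == a]
  | _, _ => false
  end.

Definition nbr sg (A : structure sg) (v : fvert A) : {set fvert A} :=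
  [set w | fadj v w].

Definition elabel sg (A : structure sg) (a : univ A) (c : constr A) : label sg :=
  existT (fun R : sym sg => {set 'I_(ar R)}) (tag (val c))
         [set i | tagged (val c) i == a].

Definition flabel sg (A : structure sg) (v w : fvert A) : option (label sg) :=
  match v, w with
  | inl a, inr c | inr c, inl a => Some (elabel a c)
  | _, _ => None
  end.

Definition kind sg (A : structure sg) (v : fvert A) : bool :=
  if v is inl _ then true else false.

(* same_delta j v w  <->  delta_j^A(v) = delta_j^B(w); for j > 0 this is the
   equality of the multisets of pairs (label, delta_{j-1}) over neighbours,
   i.e. a label- and delta_{j-1}-preserving bijection of the neighbourhoods. *)
Fixpoint same_delta sg (A B : structure sg) (j : nat) (v : fvert A) (w : fvert B)
    {struct j} : Prop :=
  match j with
  | 0 => kind v = kind w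
  | j'.+1 => exists f : fvert A -> fvert B,
      [/\ {in nbr v &, injective f}, f @: nbr v = nbr w &
          forall u, u \in nbr v -> flabel v u = flabel w (f u) /\ same_delta j' u (f u)]
  end.

(* A equiv_1 B: the multisets of sequences (delta_j(v))_{j>=0} coincide, i.e.
   a bijection between factor-graph vertices preserving every delta_j. *)
Definition equiv1 sg (A B : structure sg) : Prop :=
  exists g : fvert A -> fvert B, bijective g /\ forall j v, same_delta j v (g v).

(* tuples of length j.+1 for j : 'I_k, i.e. lengths 1..k *)
Definition tupT (T : finType) (k : nat) : finType := {j : 'I_k & {ffun 'I_j.+1 -> T}}.
Definition mktup (T : finType) k (j : 'I_k) (a : {ffun 'I_j.+1 -> T}) : tupT T k :=
  existT (fun j : 'I_k => {ffun 'I_j.+1 -> T}) j a.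

(* symbols: T_{j,S} | R_S | T_{j,i} (i in [j]^{j'}) | R_i (i in [ar R]^j) *)
Definition starsym (sg : signature) (k : nat) : finType :=
  (({j : 'I_k & {set 'I_j.+1}} + {R : sym sg & {set 'I_(ar R)}})
   + ({jj : 'I_k * 'I_k & {ffun 'I_jj.2.+1 -> 'I_jj.1.+1}}
      + {p : sym sg * 'I_k & {ffun 'I_p.2.+1 -> 'I_(ar p.1)}}))%type.

Definition starar sg k (s : starsym sg k) : nat :=
  match s with inl _ => 1 | inr _ => 2 end.

Lemma starar_pos sg k (s : starsym sg k) : 0 < starar s.
Proof. by case: s. Qed.

Definition starsig (sg : signature) (k : nat) : signature :=
  Signature (@starar_pos sg k).

Definition starU sg (A : structure sg) k : finType := (tupT (univ A) k + constr A)%type.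

Definition is_constr sg (A : structure sg) k (x : starU A k) (R : sym sg)
    (a : {ffun 'I_(ar R) -> univ A}) : bool :=
  match x with
  | inr c => val c == existT (fun R : sym sg => {ffun 'I_(ar R) -> univ A}) R a
  | inl _ => false
  end.

Definition o1 : 'I_2 := @Ordinal 2 1 isT.

Definition starrel sg (A : structure sg) k (s : sym (starsig sg k)) :
    {set {ffun 'I_(ar s) -> starU A k}} :=
  match s as s0 return {set {ffun 'I_(starar s0) -> starU A k}} with
  | inl (inl (existT j SS)) =>
      [set t : {ffun 'I_1 -> starU A k} | [exists a : {ffun 'I_j.+1 -> univ A},
          (t ord0 == inl (mktup a)) && [forall i in SS, forall i' in SS, a i == a i']]]
  | inl (inr (existT R SS)) =>
      [set t : {ffun 'I_1 -> starU A k} | [exists a : {ffun 'I_(ar R) -> univ A},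
          [&& a \in rels A R, is_constr (t ord0) a &
              [forall i in SS, forall i' in SS, a i == a i']]]]
  | inr (inl (existT jj i)) =>
      [set t : {ffun 'I_2 -> starU A k} | [exists a : {ffun 'I_jj.1.+1 -> univ A},
          (t ord0 == inl (mktup a)) &&
          (t o1 == inl (mktup [ffun m => a (i m)]))]]
  | inr (inr (existT p i)) =>
      [set t : {ffun 'I_2 -> starU A k} | [exists a : {ffun 'I_(ar p.1) -> univ A},
          [&& a \in rels A p.1, is_constr (t ord0) a &
              t o1 == inl (mktup [ffun m : 'I_p.2.+1 => a (i m)])]]]
  end.

Definition star sg (A : structure sg) (k : nat) : structure (starsig sg k) :=
  @MkStructure (starsig sg k) (starU A k) (@starrel sg A k).

Definition equivk sg (k : nat) (A B : structure sg) : Prop :=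
  if k == 1 then equiv1 A B else equiv1 (star A k) (star B k).

(* Main.v *)
Require Import Defs.
From HB Require Import structures.
From mathcomp Require Import all_boot all_order all_algebra.
From mathcomp Require Import boolp.
Set Implicit Arguments. Unset Strict Implicit. Unset Printing Implicit Defensive.
Import Order.TTheory GRing.Theory Num.Theory.

(* All four conditions are compared with the existence of a back-and-forth
   system: a family of partial isomorphisms, closed under subsets, in which
   every member p with fewer than k pairs admits a bijection f from A to B such
   that all p + (a, f a) stay in the family.

   - Duplicator follows such a system, and the positions reachable under a
     winning strategy form one.
   - Assignments satisfying the same C^k formulae, respectively giving the same
     values to all k-marked structures of treewidth < k, form one. Here the
     bijection comes from interpolation: a family of functions closed under
     products and with equal sums over A and B takes each value vector equally
     often on A and on B.
   - A system carries homomorphisms X -> A injectively to homomorphisms X -> B,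
     by transporting the elements of X one at a time along a perfect elimination
     order obtained from a tree decomposition; by symmetry the numbers agree.
   - Tuples whose entries form a member of a system are indistinguishable by
     colour refinement on A^{*k}, since extending tuples is again such a
     transport; conversely tuples with the same stable colour form a system,
     because the neighbours of a tuple in A^{*k} are its projections and
     extensions. *)

(** * Interpolation *)

(** Members of a system are sets of pairs, not pebble placements: this forgets how each condition
    labels its k slots (pebbles, variables, marks, tuple positions), and [#|p| < k] says that one
    slot can be freed. Three obstacles shape the proof. Transport along a system gives only
    injections; the swapped system gives the reverse ones, and finiteness then yields equal counts
    and bijections. Homomorphism counts cannot say that two marked elements are equal, and closed
    structures count only with all marks on one element; so the equality pattern is carried beside
    the values, and the first bijection is found on constant assignments before any single mark is
    moved. Finally, a stable colour sees A only through tuples of length at most k; because arities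
    are at most k, a constraint has a tuple listing all its entries, through which membership in a
    relation shows in the colour. For k = 1 refinement runs on A itself, where every constraint has
    a single entry. *)

Lemma color_bijection (A B : finType) (C : eqType) (cA : A -> C) (cB : B -> C) :
  (forall c, #|[pred a | cA a == c]| = #|[pred b | cB b == c]|) ->
  exists f : A -> B, bijective f /\ forall a, cB (f a) = cA a.
Proof.
move=> eq_count.
pose sA c := enum [pred a | cA a == c]; pose sB c := enum [pred b | cB b == c].
have eq_size c : size (sA c) = size (sB c) by rewrite -!cardE eq_count.
have idxA a : index a (sA (cA a)) < size (sB (cA a)).
  by rewrite -eq_size index_mem mem_enum inE.
have idxB b : index b (sB (cB b)) < size (sA (cB b)).
  by rewrite eq_size index_mem mem_enum inE.
have [A0|/card_gt0P[a0 _]] := posnP #|A|.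
  have noB (b : B) : False.
    have := eq_count (cB b); rewrite (@eq_card0 _ [pred a | _]); last first.
      by move=> a; have := fintype0 a A0.
    by move/esym/card0_eq/(_ b); rewrite !inE eqxx.
  exists (fun a => False_rect B (fintype0 a A0)).
  by split=> [|a]; [exists (fun b => False_rect A (noB b)) => x; [case: (fintype0 x A0)|case: (noB x)]|case: (fintype0 a A0)].
have [B0|/card_gt0P[b0 _]] := posnP #|B|.
  by have := leq_ltn_trans (leq0n _) (idxA a0); rewrite -cardE eq_card0 // => b; case: (fintype0 b B0).
pose f a := nth b0 (sB (cA a)) (index a (sA (cA a))).
pose g b := nth a0 (sA (cB b)) (index b (sB (cB b))).
have fc a : cB (f a) = cA a.
  by have := mem_nth b0 (idxA a); rewrite mem_enum inE => /eqP.
have gc b : cA (g b) = cB b.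
  by have := mem_nth a0 (idxB b); rewrite mem_enum inE => /eqP.
exists f; split=> //; exists g => x.
  by rewrite {1}/g fc /f index_uniq ?enum_uniq // nth_index // mem_enum inE.
by rewrite {1}/f gc /g index_uniq ?enum_uniq // nth_index // mem_enum inE.
Qed.

Section Tests.
Local Open Scope ring_scope.
Variables (A B : finType) (T : Type) (one : T) (mul : T -> T -> T).
Variable ev : T -> A + B -> int.
Hypothesis ev_one : forall w, ev one w = 1.
Hypothesis ev_mul : forall t t' w, ev (mul t t') w = ev t w * ev t' w.
Hypothesis ev_sum : forall t, \sum_a ev t (inl a) = \sum_b ev t (inr b).

Definition indist (w w' : A + B) : bool := `[< forall t, ev t w = ev t w' >].

(** Expanding one factor at a time leaves only sums of single tests, because a product of tests is a
    test; [t] is general so that it can absorb the factors already expanded. *)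
Lemma ev_sum_prod (s : seq (T * int)) t :
  \sum_a ev t (inl a) * \prod_(x <- s) (ev x.1 (inl a) - x.2)
  = \sum_b ev t (inr b) * \prod_(x <- s) (ev x.1 (inr b) - x.2).
Proof.
elim: s t => [|[u c] s IHs] t.
  by under eq_bigr do rewrite big_nil mulr1; under [RHS]eq_bigr do rewrite big_nil mulr1.
have step (I : finType) (h : I -> A + B) :
    \sum_i ev t (h i) * \prod_(x <- (u, c) :: s) (ev x.1 (h i) - x.2)
    = \sum_i ev (mul t u) (h i) * \prod_(x <- s) (ev x.1 (h i) - x.2)
      - c * \sum_i ev t (h i) * \prod_(x <- s) (ev x.1 (h i) - x.2).
  rewrite mulr_sumr -sumrB; apply: eq_bigr => i _.
  by rewrite big_cons ev_mul /= -mulrA mulrBl mulrBr [c * (_ * _)]mulrCA.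
by rewrite !step !IHs.
Qed.

(* The polynomial prod_w (t_w - t_w(w)), over all w distinguished from w0 by a
   test t_w, vanishes exactly off the class of w0. *)
Lemma indist_count (w0 : A + B) :
  #|[pred a | indist w0 (inl a)]| = #|[pred b | indist w0 (inr b)]|.
Proof.
have sep w : exists t, ~~ indist w0 w -> ev t w0 != ev t w.
  case: (boolP (indist w0 w)) => [|/asboolPn/existsNP[t /eqP]]; first by exists one.
  by exists t.
have [tw twP] := fin_all_exists sep.
pose s := [seq (tw w, ev (tw w) w) | w <- enum [pred w | ~~ indist w0 w]].
pose q w := \prod_(x <- s) (ev x.1 w - x.2).
have q_out w : ~~ indist w0 w -> q w = 0.
  move=> Hw; rewrite /q big_map (bigD1_seq w) ?enum_uniq ?mem_enum //=.
  by rewrite subrr mul0r.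
have q_in w : indist w0 w -> q w = q w0.
  by move=> /asboolP eq_w; apply: eq_bigr => x _; rewrite eq_w.
have q0 : q w0 != 0.
  rewrite /q big_map prodf_seq_neq0; apply/allP => w; rewrite mem_enum inE => Hw.
  by rewrite subr_eq0 twP.
(* Since [q] is constant on the class of [w0] and zero elsewhere, summing it counts the class; the
   common factor [q w0] is nonzero and cancels. *)
have count (I : finType) (h : I -> A + B) :
    \sum_i ev one (h i) * q (h i) = #|[pred i | indist w0 (h i)]|%:R * q w0.
  rewrite -sum1_card natr_sum mulr_suml [RHS]big_mkcond; apply: eq_bigr => i _.
  by rewrite ev_one !mul1r inE; case: ifPn => [/q_in|/q_out].
have := ev_sum_prod s one; rewrite !count => /(mulIf q0)/eqP.
by rewrite eqr_nat => /eqP.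
Qed.

Lemma test_bijection :
  exists f : A -> B, bijective f /\ forall a t, ev t (inl a) = ev t (inr (f a)).
Proof.
have refl w : indist w w by apply/asboolP.
have symi w w' : indist w w' = indist w' w.
  by apply/asboolP/asboolP => H t; rewrite H.
have tr w w' : indist w w' -> indist w =1 indist w'.
  by move=> /asboolP H v; apply/asboolP/asboolP => H' t; rewrite -H' H.
pose cl w := [set w' | indist w w'].
have clE w w' : (cl w' == cl w) = indist w w'.
  apply/eqP/idP => [/setP/(_ w')|/tr e]; first by rewrite !inE refl => /esym.
  by apply/setP => v; rewrite !inE e.
have [c|f [bf Hf]] := @color_bijection A B _ (cl \o inl) (cl \o inr).
  have [/existsP[w /eqP ->]|none] := boolP [exists w, c == cl w].
    have E (I : finType) (h : I -> A + B) :
        #|[pred i | cl (h i) == cl w]| = #|[pred i | indist w (h i)]|.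
      by apply: eq_card => i; rewrite !inE clE.
    by rewrite /= !E indist_count.
  by rewrite !eq_card0 // => x; rewrite !inE /=; apply: contraNF none => /eqP <-;
     apply/existsP; eexists; apply/eqP.
exists f; split=> // a.
by apply/asboolP; have := Hf a => /= /eqP; rewrite clE.
Qed.
End Tests.

(** * Back-and-forth systems, the pebble game and counting logic *)

Record bf_system sg (k : nat) (A B : structure sg)
    (P : {set univ A * univ B} -> Prop) : Prop := BfSystem {
  bf_empty : P set0;
  bf_subset : forall p q : {set univ A * univ B}, q \subset p -> P p -> P q;
  bf_iso : forall p, P p -> partial_iso (fun a b => (a, b) \in p);
  bf_forth : forall p, P p -> #|p| < k ->
    exists f : univ A -> univ B, bijective f /\ forall a, P ((a, f a) |: p) }.

(** Fixing one bijection for each set of pairs makes later transport a function of those pairs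
    alone, which is what allows it to be inverted. Sets that are full or outside [P] receive the
    filler [f0], obtained from the empty set by [0 < k]. *)
Lemma bf_choice sg k (A B : structure sg) (P : {set univ A * univ B} -> Prop) :
  0 < k -> bf_system k P ->
  exists F : {set univ A * univ B} -> univ A -> univ B,
    (forall p, bijective (F p)) /\
    (forall p a, P p -> #|p| < k -> P ((a, F p a) |: p)).
Proof.
move=> k0 bf.
have [f0 [bf0 _]] : exists f0 : univ A -> univ B, bijective f0 /\
    forall a, P ((a, f0 a) |: set0).
  by apply: (bf_forth bf (bf_empty bf)); rewrite cards0.
have ex p : exists f : univ A -> univ B, bijective f /\
    (P p -> #|p| < k -> forall a, P ((a, f a) |: p)).
  case: (pselect (P p)) => [Pp|nP]; last by exists f0.
  case: (boolP (#|p| < k)) => [pk|_]; last by exists f0.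
  by have [f [? ?]] := bf_forth bf Pp pk; exists f.
have [F FP] := fin_all_exists ex.
by exists F; split=> [p|p a Pp pk]; case: (FP p) => // _; apply.
Qed.

Lemma bij_card_pred (A B : finType) (f : A -> B) (Q : pred B) :
  bijective f -> #|[pred a | Q (f a)]| = #|[pred b | Q b]|.
Proof.
move=> bf; rewrite -!sum1_card [RHS](reindex f) //=; exact: onW_bij.
Qed.

Section Pebbles.
Variables (A B : finType) (k : nat).
Implicit Types (al : 'I_k -> option A) (be : 'I_k -> option B) (J : {set 'I_k}).

Definition pebs J al be : {set A * B} :=
  [set x | [exists j in J, (al j == Some x.1) && (be j == Some x.2)]].

Lemma pebsP J al be a b :
  reflect (exists2 j, j \in J & al j = Some a /\ be j = Some b)
          ((a, b) \in pebs J al be).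
Proof.
rewrite inE; apply: (iffP exists_inP) => [[j Jj /andP[/eqP ? /eqP ?]]|[j Jj [ea eb]]].
  by exists j.
by exists j; rewrite // ea eb !eqxx.
Qed.

Lemma card_pebs J al be : #|pebs J al be| <= #|J|.
Proof.
pose f (x : A * B) := (Some x.1, Some x.2).
have injf : injective f by move=> [? ?] [? ?] [-> ->].
rewrite -(card_imset _ injf).
apply: leq_trans (leq_imset_card (fun j => (al j, be j)) J).
apply/subset_leq_card/subsetP => _ /imsetP[[a b] /pebsP[j Jj [ea eb]] ->].
by apply/imsetP; exists j; rewrite // ea eb.
Qed.

Lemma pebs_sub J J' al be : J \subset J' -> pebs J al be \subset pebs J' al be.
Proof.
move=> /subsetP sJ; apply/subsetP => -[a b] /pebsP[j Jj e].
by apply/pebsP; exists j; first exact: sJ.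
Qed.

Lemma pebs_upd al be i a b :
  pebs setT (upd al i (Some a)) (upd be i (Some b)) = (a, b) |: pebs [set~ i] al be.
Proof.
apply/setP => -[c d]; rewrite in_setU1; apply/pebsP/orP => [[j _]|].
  rewrite /upd; case: eqP => [_ [[->] [->]]|/eqP ji e]; first by left.
  by right; apply/pebsP; exists j; rewrite ?in_setC1.
case=> [/eqP[-> ->]|/pebsP[j]]; first by exists i; rewrite // /upd eqxx.
by rewrite in_setC1 => /negbTE ji e; exists j; rewrite // /upd ji.
Qed.

Lemma card_setC1_lt (i : 'I_k) : #|[set~ i]| < k.
Proof. by have := cardsC1 i; rewrite card_ord => ->; case: k i => [[]|]. Qed.

(** One pebble chosen for each pair of [p] occupies fewer than [k] pebbles; any pebble not chosen
    can be lifted, even if it stands on a pair of [p]. *)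
Lemma pebs_free (p : {set A * B}) al be :
  p \subset pebs setT al be -> #|p| < k ->
  exists i, p \subset pebs [set~ i] al be.
Proof.
move=> /subsetP sp pk.
have ex x : exists j : 'I_k, x \in p -> al j = Some x.1 /\ be j = Some x.2.
  have [/sp|_] := boolP (x \in p); last by exists (Ordinal (leq_ltn_trans (leq0n _) pk)).
  by case: x => a b /pebsP[j _ e]; exists j.
have [c cP] := fin_all_exists ex.
have /existsP[i iP] : [exists i, i \notin c @: p].
  rewrite -negb_forall; apply: contraTN pk => /forallP full; rewrite -leqNgt.
  apply: leq_trans (leq_imset_card c p); rewrite -[X in X <= _]card_ord -cardsT.
  by apply/subset_leq_card/subsetP => i _; apply: full.
exists i; apply/subsetP => -[a b] abp; apply/pebsP; exists (c (a, b)); last exact: (cP _ abp).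
by rewrite in_setC1; apply: contraNneq iP => <-; apply: imset_f.
Qed.
End Pebbles.

Lemma partial_isoE sg (A B : structure sg) (p q : univ A -> univ B -> bool) :
  p =2 q -> partial_iso p -> partial_iso q.
Proof.
move=> e [p1 p2 p3]; split=> [a b b'|a a' b|R t u tu]; rewrite -?e; first exact: p1.
  exact: p2.
by apply: p3 => i; rewrite e.
Qed.

Lemma pebble_mapE sg (A B : structure sg) k (al : 'I_k -> option (univ A))
    (be : 'I_k -> option (univ B)) a b :
  pebble_map al be a b = ((a, b) \in pebs setT al be).
Proof. by rewrite inE; apply: eq_existsb => i; rewrite inE. Qed.

(** * Duplicator's strategies *)

Section Game.
Variables (sg : signature) (k : nat) (A B : structure sg).

Lemma bf_dup_wins (P : {set univ A * univ B} -> Prop) :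
  0 < k -> bf_system k P -> dup_wins k A B.
Proof.
move=> k0 bf; have [F [Fbij FP]] := bf_choice k0 bf.
split; first exact: bij_eq_card (Fbij set0).
pose pos0 : ('I_k -> option (univ A)) * ('I_k -> option (univ B)) :=
  (fun=> None, fun=> None).
(* The strategy is to depend on positions that it produces itself. To break the circle, positions
   are folded directly with [F], and [runE] shows afterwards that a run under [st] reaches the same
   ones. *)
pose step (pos : ('I_k -> option (univ A)) * ('I_k -> option (univ B)))
    (m : 'I_k * univ A) :=
  (upd pos.1 m.1 (Some m.2),
   upd pos.2 m.1 (Some (F (pebs [set~ m.1] pos.1 pos.2) m.2))).
pose pos past := foldl step pos0 past.
pose st : strategy A B k := fun past i => F (pebs [set~ i] (pos past).1 (pos past).2).
have runE h past : run st past h (pos past).1 (pos past).2 = pos (past ++ h).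
  elim: h past => [|[i a] h IH] past /=; first by rewrite cats0; case: (pos past).
  by rewrite -cat_rcons -IH /pos foldl_rcons.
have inv h : P (pebs setT (pos h).1 (pos h).2).
  elim/last_ind: h => [|h [i a] IH].
    apply: (bf_subset bf) (bf_empty bf); apply/subsetP => -[a b] /pebsP[j _ []] //.
  rewrite /pos foldl_rcons -/(pos h) /= pebs_upd; apply: FP.
    exact: bf_subset bf _ _ (pebs_sub _ _ (subsetT _)) IH.
  exact: leq_ltn_trans (card_pebs _ _ _) (card_setC1_lt i).
exists st; split=> [past i|h /=]; first exact: Fbij.
have -> := runE h [::].
by apply: partial_isoE (bf_iso bf (inv h)) => a b; rewrite pebble_mapE.
Qed.

Lemma run_rcons (st : strategy A B k) past h i a al be :
  let pos := run st past h al be in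
  run st past (rcons h (i, a)) al be =
  (upd pos.1 i (Some a), upd pos.2 i (Some (st (past ++ h) i a))).
Proof.
elim: h past al be => [|[j c] h IH] past al be /=; first by rewrite cats0.
by rewrite IH cat_rcons.
Qed.

Lemma dup_wins_bf : dup_wins k A B -> exists P, bf_system k (A := A) (B := B) P.
Proof.
move=> [_ [st [st_bij st_win]]].
pose pos h := run st [::] h (fun=> None) (fun=> None).
exists (fun p : {set univ A * univ B} => exists h, p \subset pebs setT (pos h).1 (pos h).2); split.
- by exists [::]; apply: sub0set.
- by move=> p q qp [h ph]; exists h; apply: subset_trans ph.
- move=> p [h /subsetP ph]; have [w1 w2 w3] := st_win h.
  have sub a b : (a, b) \in p -> pebble_map (pos h).1 (pos h).2 a b.
    by move=> /ph; rewrite pebble_mapE.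
  split=> [a b b' /sub ab /sub|a a' b /sub ab /sub|R t u tu].
  + exact: w1.
  + exact: w2.
  + by apply: w3 => i; apply: sub.
- move=> p [h ph] pk; have [i pi] := pebs_free ph pk.
  exists (st h i); split=> [|a]; first exact: st_bij.
  exists (rcons h (i, a)); rewrite /pos run_rcons /= pebs_upd.
  exact: setUS.
Qed.
End Game.

(** * Counting logic with k variables *)

Section Logic.
Variables (sg : signature) (k : nat).

Lemma sat_atom (A : structure sg) (al : 'I_k -> option (univ A)) R v
    (t : {ffun 'I_(ar R) -> univ A}) :
  (forall i, al (v i) = Some (t i)) -> sat A al (FAtom v) = (t \in rels A R).
Proof.
move=> alt; apply/existsP/idP => [[u /andP[/forallP ut uR]]|tR].
  by have -> : t = u by apply/ffunP => i; apply/Some_inj; rewrite -alt (eqP (ut i)).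
by exists t; rewrite tR andbT; apply/forallP => i; rewrite alt.
Qed.

Lemma assignment_total (T : finType) (al : 'I_k -> option T) n (v : 'I_n -> 'I_k) :
  (forall i, al (v i) != None) ->
  exists t : {ffun 'I_n -> T}, forall i, al (v i) = Some (t i).
Proof.
move=> H; have ex i : exists c, al (v i) = Some c.
  by move: (H i); case: (al (v i)) => // c _; exists c.
have [t tP] := fin_all_exists ex; exists [ffun i => t i] => i.
by rewrite ffunE.
Qed.

(** The set of pairs loses a variable assigned on one side only, hence the separate hypothesis that
    both assignments have the same domain. Quantifying over [x] lifts pebble [x], which leaves fewer
    than [k] pairs, and the bijection of the system matches the witnesses. *)
Lemma bf_sat (A B : structure sg) (P : {set univ A * univ B} -> Prop) :
  bf_system k P ->
  forall (phi : formula sg k) al be, P (pebs setT al be) ->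
    (forall i, (al i == None) = (be i == None)) -> sat A al phi = sat B be phi.
Proof.
move=> bf; elim=> [R v|x y|p IH|p IHp q IHq|p IHp q IHq|n x p IH] al be Pab dom.
- have [w1 w2 w3] := bf_iso bf Pab.
  have [/forallP Dal|] := boolP [forall i, al (v i) != None].
    have [t tP] := assignment_total Dal.
    have [u uP] : exists u : {ffun 'I_(ar R) -> univ B}, forall i, be (v i) = Some (u i).
      by apply: assignment_total => i; rewrite -dom.
    rewrite (sat_atom tP) (sat_atom uP); apply: w3 => i; apply/pebsP.
    by exists (v i).
  rewrite negb_forall => /existsP[i]; rewrite negbK => Ni.
  transitivity false; [|symmetry]; apply/existsP => -[t /andP[/forallP/(_ i)]].
    by rewrite (eqP Ni).
  by move: Ni; rewrite dom => /eqP ->.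
- have [w1 w2 w3] := bf_iso bf Pab; rewrite /=; move: (dom x) (dom y).
  case eax: (al x) => [a|]; case ebx: (be x) => [b|] //= _.
  case eay: (al y) => [a'|]; case eby: (be y) => [b'|] //= _.
  have Hx : (a, b) \in pebs setT al be by apply/pebsP; exists x.
  have Hy : (a', b') \in pebs setT al be by apply/pebsP; exists y.
  apply/eqP/eqP => -[e]; move: Hx Hy; rewrite -e => Hx Hy; congr Some.
    exact: w1 Hx Hy.
  exact: w2 Hx Hy.
- by rewrite /= (IH _ _ Pab).
- by rewrite /= (IHp _ _ Pab) // (IHq _ _ Pab).
- by rewrite /= (IHp _ _ Pab) // (IHq _ _ Pab).
- have P0 : P (pebs [set~ x] al be).
    exact: bf_subset bf _ _ (pebs_sub _ _ (subsetT _)) Pab.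
  have [f [fbij fP]] := bf_forth bf P0
    (leq_ltn_trans (card_pebs _ _ _) (card_setC1_lt x)).
  rewrite /= -(bij_card_pred (fun b => sat B (upd be x (Some b)) p) fbij).
  congr (_ <= _); apply: eq_card => a; rewrite !inE; apply: IH => [|i].
    by rewrite pebs_upd; apply: fP.
  by rewrite /upd; case: (i == x).
Qed.

Lemma bf_Ck_equiv (A B : structure sg) (P : {set univ A * univ B} -> Prop) :
  bf_system k P -> Ck_equiv k A B.
Proof.
move=> bf phi _; apply: (bf_sat bf) => //; apply: (bf_subset bf) (bf_empty bf).
by apply/subsetP => -[a b] /pebsP[j _ []].
Qed.

Definition adom (T : finType) (al : 'I_k -> option T) : {set 'I_k} :=
  [set i | al i != None].

Lemma adom_upd (T : finType) (al : 'I_k -> option T) i a :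
  adom (upd al i (Some a)) = i |: adom al.
Proof. by apply/setP => j; rewrite !inE /upd; case: (j == i). Qed.

Definition Ck_same (A B : structure sg) (al : 'I_k -> option (univ A))
    (be : 'I_k -> option (univ B)) : Prop :=
  forall phi : formula sg k, fv phi \subset adom al -> sat A al phi = sat B be phi.

(** Interpolation with formulae as tests: conjunction is the product, [x_i = x_i] the constant one,
    and the value is the truth value. Equal sums mean equally many witnesses, which holds because
    every threshold is expressed by some [FExistsN]. *)
Lemma Ck_forth (A B : structure sg) al be i :
  Ck_same (A := A) (B := B) al be ->
  exists f : univ A -> univ B, bijective f /\
    forall a, Ck_same (upd al i (Some a)) (upd be i (Some (f a))).
Proof.
move=> same.
pose fvok (phi : formula sg k) : bool := fv phi \subset i |: adom al.
pose T := {phi | fvok phi}.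
have one_fv : fv (FEq sg i i) \subset i |: adom al.
  by apply/subsetP => j; rewrite !inE orbb => ->.
pose one : T := exist fvok _ one_fv.
have mul_fv (t t' : T) : fv (FAnd (sval t) (sval t')) \subset i |: adom al.
  by rewrite /= subUset; apply/andP; split; [exact: (svalP t)|exact: (svalP t')].
pose mul (t t' : T) : T := exist fvok _ (mul_fv t t').
pose sat' (t : T) (w : univ A + univ B) : bool :=
  match w with inl a => sat A (upd al i (Some a)) (sval t)
             | inr b => sat B (upd be i (Some b)) (sval t) end.
pose ev (t : T) w : int := ((sat' t w : nat)%:R)%R.
have [||t|f [fbij fP]] := @test_bijection _ _ T one mul ev.
- by case=> x; rewrite /ev /= /upd eqxx /= eqxx.
- by move=> t t' [x|x]; rewrite /ev /= -natrM mulnb.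
- have sumE (I : finType) (h : I -> univ A + univ B) :
      (\sum_i ev t (h i) = (#|[pred i | sat' t (h i)]|)%:R)%R.
    by rewrite -sum1_card natr_sum [RHS]big_mkcond; apply: eq_bigr => x _;
       rewrite inE /ev; case: (sat' t (h x)).
  rewrite !sumE; congr (_%:R)%R.
  have key n := same (FExistsN n i (sval t)).
  have le n : (n <= #|[pred a | sat' t (inl a)]|) = (n <= #|[pred b | sat' t (inr b)]|).
    apply: key => /=; rewrite subDset; exact: (svalP t).
  by apply/eqP; rewrite eqn_leq -le leqnn le leqnn.
exists f; split=> // a phi; rewrite adom_upd => fvphi.
have := fP a (exist fvok phi fvphi); rewrite /ev /= => /eqP; rewrite eqr_nat.
by case: sat; case: sat.
Qed.

Lemma Ck_equiv_bf (A B : structure sg) :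
  Ck_equiv k A B -> exists P, bf_system k (A := A) (B := B) P.
Proof.
move=> AB.
exists (fun p : {set univ A * univ B} => exists al be, [/\ p \subset pebs setT al be, adom al = adom be
  & Ck_same (A := A) (B := B) al be]); split.
- exists (fun=> None), (fun=> None); split; first exact: sub0set.
    by apply/setP => i; rewrite !inE.
  move=> phi fv0; apply: AB; apply/eqP; rewrite -subset0.
  by apply: subset_trans fv0 _; apply/subsetP => i; rewrite inE eqxx.
- by move=> p q qp [al [be [pab ? ?]]]; exists al, be; split=> //; apply: subset_trans pab.
- move=> p [al [be [/subsetP pab dom same]]]; split.
  + move=> a b b' /pab/pebsP[i _ [ai bi]] /pab/pebsP[j _ [aj bj]].
    have := same (FEq sg i j); rewrite /= ai aj bi bj eqxx /= => e.
    apply/Some_inj/eqP; rewrite -e //.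
    by apply/subsetP => x; rewrite !inE => /orP[]/eqP ->; rewrite ?ai ?aj.
  + move=> a a' b /pab/pebsP[i _ [ai bi]] /pab/pebsP[j _ [aj bj]].
    have := same (FEq sg i j); rewrite /= ai aj bi bj eqxx /= => e.
    apply/Some_inj/eqP; rewrite e //.
    by apply/subsetP => x; rewrite !inE => /orP[]/eqP ->; rewrite ?ai ?aj.
  + move=> R t u tu.
    have ex i : exists j, al j = Some (t i) /\ be j = Some (u i).
      by have /pab/pebsP[j _ e] := tu i; exists j.
    have [v vP] := fin_all_exists ex.
    rewrite -(@sat_atom A al R v) => [|i]; last by case: (vP i).
    rewrite -(@sat_atom B be R v) => [|i]; last by case: (vP i).
    apply: same; apply/subsetP => _ /imsetP[i _ ->]; rewrite inE.
    by case: (vP i) => ->.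
- move=> p [al [be [pab dom same]]] pk; have [i pi] := pebs_free pab pk.
  have [f [fbij fP]] := Ck_forth i same; exists f; split=> // a.
  exists (upd al i (Some a)), (upd be i (Some (f a))).
  by rewrite pebs_upd !adom_upd dom; split=> //; apply: setUS.
Qed.
End Logic.

(** * From systems to homomorphism counts *)

Definition gr (Y A B : finType) (C : {set Y}) (h : Y -> A) (h' : Y -> B) : {set A * B} :=
  [set (h y, h' y) | y in C].

Lemma mem_gr (Y A B : finType) (C : {set Y}) (h : Y -> A) (h' : Y -> B) y :
  y \in C -> (h y, h' y) \in gr C h h'.
Proof. by move=> yC; apply/imsetP; exists y. Qed.

Lemma gr_sub (Y A B : finType) (C D : {set Y}) (h : Y -> A) (h' : Y -> B) :
  C \subset D -> gr C h h' \subset gr D h h'.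
Proof. exact: imsetS. Qed.

Lemma eq_gr (Y A B : finType) (C : {set Y}) (h g : Y -> A) (h' g' : Y -> B) :
  {in C, h =1 g} -> {in C, h' =1 g'} -> gr C h h' = gr C g g'.
Proof. by move=> e e'; apply: eq_in_imset => y yC; rewrite e ?e'. Qed.

(** * Elimination orders with cliques of size at most k *)

Section Elim.
Variables (Y : finType) (k : nat).

Definition cov (L : seq {set Y}) : {set Y} := \bigcup_(D <- L) D.

Lemma mem_cov (L : seq {set Y}) C y : C \in L -> y \in C -> y \in cov L.
Proof. by move=> CL yC; rewrite /cov (big_rem C) //= inE yC. Qed.

(* L lists the cliques of a chordal graph with a fixed base clique M, in the
   reverse of a perfect elimination order. *)
Inductive elim (M : {set Y}) : seq {set Y} -> Prop :=
| elim_base : elim M [:: M]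
| elim_step L C (N : {set Y}) y : elim M L -> C \in L -> N \subset C -> #|N| < k ->
    y \notin cov L -> elim M ((y |: N) :: L).

Lemma elim_mem M L : elim M L -> M \in L.
Proof. by elim=> [|L' C N y _ IH *]; rewrite inE ?eqxx ?IH ?orbT. Qed.

Lemma cov_step (L : seq {set Y}) (C N : {set Y}) y : C \in L -> N \subset C -> cov ((y |: N) :: L) = y |: cov L.
Proof.
move=> CL /subsetP NC; rewrite /cov big_cons -setUA; congr (_ |: _).
by apply/setUidPr/subsetP => z /NC; apply: mem_cov.
Qed.

(** The elements of [E] outside the cover enter one at a time, each attached to the part of [E]
    already covered; that part misses the new element, so it has fewer than [k] elements. *)
Lemma elim_add M L C (E : {set Y}) :
  elim M L -> C \in L -> E :&: cov L \subset C -> #|E| <= k ->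
  exists L', [/\ elim M L', {subset L <= L'}, cov L' = cov L :|: E &
    exists2 C', C' \in L' & E \subset C'].
Proof.
have [n] := ubnP #|E :\: cov L|; elim: n => // n IH in L C * => len eL CL EC Ek.
have [E0|/set0Pn[y]] := eqVneq (E :\: cov L) set0.
  have EcL : E \subset cov L by rewrite -setD_eq0 E0.
  exists L; split=> //; first by rewrite (setUidPl EcL).
  by exists C; rewrite // -(setIidPl EcL).
rewrite inE => /andP[yL yE].
have Nk : #|E :&: cov L| < k.
  apply: leq_trans Ek; apply: proper_card; apply/properP; split; first exact: subsetIl.
  by exists y; rewrite // inE yE.
have cov1 := cov_step y CL EC.
have [|||||L' [eL' sL' cL' exC']] := IH ((y |: (E :&: cov L)) :: L) (y |: (E :&: cov L)).
- rewrite cov1; rewrite ltnS in len; apply: leq_trans len; apply: proper_card; apply/properP; split.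
    by apply: setDS; apply: subsetUr.
  by exists y; rewrite !inE ?eqxx ?yL.
- exact: elim_step eL CL EC Nk yL.
- by rewrite inE eqxx.
- by rewrite cov1; apply/subsetP => z; rewrite !inE => /andP[-> /orP[->|->]]; rewrite ?orbT.
- exact: Ek.
exists L'; split=> // [D DL|]; first by apply: sL'; rewrite inE DL orbT.
rewrite cL' cov1; apply/setP => z; rewrite !inE -orbA orbCA.
by case: eqP => // ->; rewrite yE orbT.
Qed.
End Elim.

Section Transfer.
Variables (sg : signature) (k : nat) (A B : structure sg).
Variable P : {set univ A * univ B} -> Prop.
Hypotheses (k0 : 0 < k) (bf : bf_system k P).

(** The image of [h] at a new vertex [y] comes from the bijection chosen for the pairs over [N], so
    it depends only on [h y] and on earlier vertices. Decoding in the same order recovers [h] from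
    [F h]. The values on the base clique are prescribed by [a0] and [b0]. *)
Lemma elim_transfer (Y : finType) (M : {set Y}) L
    (a0 : {ffun Y -> univ A}) (b0 : {ffun Y -> univ B}) :
  P (gr M a0 b0) -> elim k M L ->
  exists F : {ffun Y -> univ A} -> {ffun Y -> univ B},
    (forall h : {ffun Y -> univ A}, {in M, h =1 a0} ->
       {in M, F h =1 b0} /\ forall C, C \in L -> P (gr C h (F h))) /\
    (forall h g : {ffun Y -> univ A}, {in M, h =1 a0} -> {in M, g =1 a0} ->
       {in cov L, F h =1 F g} -> {in cov L, h =1 g}).
Proof.
move=> P0; have [FF [FFbij FFP]] := bf_choice k0 bf.
elim=> [|{}L C N y eL [F [F1 F2]] CL NC Nk yL].
  exists (fun=> b0); split=> [h ha|h g ha ga _ z].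
    by split=> // C; rewrite inE => /eqP ->; rewrite (@eq_gr _ _ _ _ h a0 b0 b0).
  by rewrite /cov big_seq1 => zM; rewrite ha ?ga.
pose F' (h : {ffun Y -> univ A}) := [ffun z => if z == y then FF (gr N h (F h)) (h y) else F h z].
have yN D z : D \in L -> z \in D -> (z == y) = false.
  by move=> DL zD; apply: contraNF yL => /eqP <-; apply: mem_cov zD.
have F'E h D : D \in L -> {in D, F' h =1 F h}.
  by move=> DL z zD; rewrite ffunE (yN D).
have F'N h : {in N, F' h =1 F h}.
  by move=> z /(subsetP NC); apply: F'E CL z.
have NL : N \subset cov L by apply/subsetP => z /(subsetP NC); apply: mem_cov.
exists F'; split=> [h ha|h g ha ga eF].
  have [hM hL] := F1 h ha; split=> [z zM|D].
    by rewrite (F'E h M) ?(elim_mem eL) ?hM.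
  rewrite inE => /predU1P[->|DL].
    rewrite /gr imsetU1 -/(gr N h (F' h)) (eq_gr (h := h) (g := h) (fun _ _ => erefl) (F'N h)).
    rewrite ffunE eqxx; apply: FFP; first exact: bf_subset bf _ _ (gr_sub _ _ NC) (hL C CL).
    exact: leq_ltn_trans (leq_imset_card _ _) Nk.
  by rewrite (eq_gr (h := h) (g := h) (fun _ _ => erefl) (F'E h D DL)); apply: hL.
rewrite (cov_step y CL NC) in eF *.
have eFL : {in cov L, F h =1 F g}.
  move=> z zL; have := eF z; rewrite !ffunE in_setU1 zL orbT => /(_ isT).
  by case: eqP => // zy; rewrite -zy zL in yL.
have ehL := F2 h g ha ga eFL.
move=> z; rewrite in_setU1 => /predU1P[->|]; last exact: ehL.
have := eF y; rewrite !ffunE in_setU1 eqxx => /(_ isT).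
have -> : gr N h (F h) = gr N g (F g).
  by apply: eq_gr => x /(subsetP NL); [apply: ehL|apply: eFL].
exact: (bij_inj (FFbij _)).
Qed.

(** Each constraint of [X] lies in a single clique, on which [h] and [F h] form a partial
    isomorphism; hence [F] sends homomorphisms to homomorphisms, and it is injective because the
    cliques cover [X]. *)
Lemma nhom_leq (X : structure sg) L :
  elim k set0 L -> cov L = setT ->
  (forall R (t : {ffun 'I_(ar R) -> univ X}), t \in rels X R ->
     exists2 C, C \in L & forall i, t i \in C) ->
  nhom X A <= nhom X B.
Proof.
move=> eL covL relL.
have [-> //|] := posnP (nhom X A).
case/card_gt0P => h0; rewrite inE => hom0.
have [f0 _] := bf_forth bf (bf_empty bf) (eq_ind_r (fun n => n < k) k0 (cards0 _)).
have P0 : P (gr set0 h0 [ffun y => f0 (h0 y)]) by rewrite /gr imset0; apply: bf_empty bf.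
have [F [F1 F2]] := elim_transfer P0 eL.
have in0 (h : {ffun univ X -> univ A}) : {in set0, h =1 h0} by move=> z; rewrite inE.
rewrite /nhom -(card_imset _ (f := F)) => [|h g e]; last first.
  by apply/ffunP => y; apply: (F2 h g (in0 h) (in0 g)) => [z _|]; rewrite ?e ?covL ?inE.
apply/subset_leq_card/subsetP => _ /imsetP[h + ->]; rewrite !inE => /forallP homh.
apply/forallP => R; apply/forallP => t; apply/implyP => tR.
have [C CL tC] := relL R t tR.
have [_ _ isoR] := bf_iso bf ((F1 h (in0 h)).2 C CL).
rewrite -(isoR R [ffun i => h (t i)]) => [|i]; last by rewrite !ffunE; apply: mem_gr.
by have /forallP/(_ t)/implyP := homh R; apply.
Qed.
End Transfer.

Section Symmetry.
Variables (sg : signature) (k : nat).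

Definition swap (A B : finType) (p : {set A * B}) : {set B * A} :=
  [set (x.2, x.1) | x in p].

Lemma mem_swap (A B : finType) (p : {set A * B}) a b :
  ((b, a) \in swap p) = ((a, b) \in p).
Proof.
by apply/imsetP/idP => [[[c d] cp [-> ->]] //|abp]; exists (a, b).
Qed.

Lemma card_swap (A B : finType) (p : {set A * B}) : #|swap p| = #|p|.
Proof. by apply: card_imset => -[? ?] [? ?] [-> ->]. Qed.

Lemma bf_sym (A B : structure sg) (P : {set univ A * univ B} -> Prop) :
  bf_system k P -> bf_system k (A := B) (B := A) (P \o @swap _ _).
Proof.
move=> bf; split=> /=.
- by rewrite /swap imset0; apply: bf_empty bf.
- by move=> p q qp; apply: bf_subset bf _ _ _; apply: imsetS.
- move=> p /(bf_iso bf)[w1 w2 w3]; split=> [a b b'|a a' b|R t u tu].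
  + by move=> ab ab'; apply: (w2 _ _ a); rewrite mem_swap.
  + by move=> ab ab'; apply: (w1 b); rewrite mem_swap.
  + by symmetry; apply: w3 => i; rewrite mem_swap.
- move=> p Pp; rewrite -card_swap => /(bf_forth bf Pp)[f [[g fg gf] fP]].
  exists g; split=> [|b]; first by exists f.
  by rewrite /swap imsetU1 /= -{2}[b]gf; apply: fP.
Qed.
End Symmetry.

(** * From tree decompositions to elimination orders *)

Section Tree.
Variables (V : finType) (e : rel V).

(** A simple path from [v] to [u] avoiding the edge between them would close up with it to a
    cycle. *)
Lemma tree_cut u v : is_tree e -> e u v ->
  ~~ connect [rel a b | [&& e a b, (a, b) != (u, v) & (a, b) != (v, u)]] v u.
Proof.
move=> [_ syme irre _ acyc] euv; apply/negP => /connectP[p0 path0 last0].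
case/shortenP: path0 last0 => p path_p uniq_p _ last_p {p0}.
have sz : 2 < size (v :: p).
  case: p path_p {uniq_p} last_p => [|x [|y p]] //=.
    by move=> _ uv; rewrite uv irre in euv.
  by rewrite andbT => /and3P[_ _ /negP H] xu; case: H; rewrite xu.
have /negP[] := acyc _ uniq_p sz.
rewrite /= rcons_path -last_p euv andbT.
by apply: sub_path path_p => a b /andP[].
Qed.

Lemma connect_exit (W : {set V}) w x :
  symmetric e -> w \in W -> x \notin W -> connect e w x ->
  exists u v, [/\ u \in W, v \notin W & e u v].
Proof.
move=> syme wW xW con.
have [/existsP[u /existsP[v /and3P[]]]|none] :=
  boolP [exists u, exists v, [&& u \in W, v \notin W & e u v]]; first by exists u, v.
have clW : closed e (mem W).
  apply: intro_closed; first exact: sym_connect_sym.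
  move=> u v euv uW; apply: contraR none => vW.
  by apply/existsP; exists u; apply/existsP; exists v; apply/and3P.
by move: xW; rewrite -(closed_connect clW con) wW.
Qed.

Definition conn_in (W : {set V}) : Prop :=
  {in W &, forall u w, connect [rel a b | [&& e a b, a \in W & b \in W]] u w}.

Lemma conn_in_add (W : {set V}) u v :
  symmetric e -> conn_in W -> u \in W -> e u v -> conn_in (v |: W).
Proof.
move=> syme cW uW euv.
set r := [rel a b | [&& e a b, a \in v |: W & b \in v |: W]].
have symr : connect_sym r.
  by apply: sym_connect_sym => a b; rewrite /= syme; congr (_ && _); rewrite andbC.
have tou w : w \in v |: W -> connect r u w.
  rewrite in_setU1 => /predU1P[->|wW].
    by apply: connect1; rewrite /= euv !inE uW eqxx orbT.
  apply: connect_sub (cW u w uW wW) => a b /and3P[eab aW bW].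
  by apply: connect1; rewrite /= eab !inE aW bW !orbT.
move=> w w' Ww Ww'; apply: (@connect_trans _ _ u); last exact: tou.
by rewrite symr; apply: tou.
Qed.

(** Otherwise the bags containing [y] give a walk from [v] to [w] that avoids [u], and [W] gives one
    from [w] to [u] that avoids [v]; together they bypass the edge between [u] and [v],
    contradicting [tree_cut]. *)
Lemma running_intersection (Y : finType) (beta : V -> {set Y}) (W : {set V}) u v w y :
  is_tree e ->
  (forall x v w, x \in beta v -> x \in beta w ->
     connect [rel a b | [&& e a b, x \in beta a & x \in beta b]] v w) ->
  conn_in W -> u \in W -> v \notin W -> e u v -> w \in W ->
  y \in beta w -> y \in beta v -> y \in beta u.
Proof.
move=> tree conn cW uW vW euv wW yw yv; have /negP := tree_cut tree euv.
apply: contra_notT => yu; apply: (@connect_trans _ _ w).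
  apply: connect_sub (conn y v w yv yw) => a b /and3P[eab ya yb].
  apply: connect1; rewrite /= eab !xpair_eqE.
  have -> : (a == u) = false by apply: contraNF yu => /eqP <-.
  have -> : (b == u) = false by apply: contraNF yu => /eqP <-.
  by rewrite andbF.
apply: connect_sub (cW w u wW uW) => a b /and3P[eab Wa Wb].
apply: connect1; rewrite /= eab !xpair_eqE.
have -> : (a == v) = false by apply: contraNF vW => /eqP <-.
have -> : (b == v) = false by apply: contraNF vW => /eqP <-.
by rewrite andbF.
Qed.

Lemma tree_elim (Y : finType) k (beta : V -> {set Y}) :
  is_tree e ->
  (forall x v w, x \in beta v -> x \in beta w ->
     connect [rel a b | [&& e a b, x \in beta a & x \in beta b]] v w) ->
  (forall v, #|beta v| <= k) ->
  exists L, elim k set0 L /\ forall v, exists2 C, C \in L & beta v \subset C.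
Proof.
move=> tree conn betak; have [V0 syme irre cone _] := tree.
(* The nodes are absorbed one at a time with their set [W] kept connected, so that a new bag meets
   everything covered so far inside the bag of its neighbour in [W]. *)
have claim n : n <= #|V| -> exists W : {set V}, [/\ #|W| = n, conn_in W &
    exists L, [/\ elim k set0 L, cov L = \bigcup_(v in W) beta v &
      forall v, v \in W -> exists2 C, C \in L & beta v \subset C]].
  elim: n => [_|n IH nV].
    exists set0; split; [exact: cards0|by move=> u w; rewrite inE|].
    exists [:: set0]; split=> [||v]; rewrite ?inE //; first exact: elim_base.
    by rewrite big_set0 /cov big_seq1.
  have [W [Wn cW [L [eL covL WL]]]] := IH (ltnW nV).
  have [v [vW cvW [C CL HC]]] : exists v, [/\ v \notin W, conn_in (v |: W) &
      exists2 C, C \in L & beta v :&: cov L \subset C].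
    have [W0|/set0Pn[w wW]] := eqVneq W set0.
      have /card_gt0P[v _] := V0; exists v; split; first by rewrite W0 inE.
        by rewrite W0 setU0 => x y /set1P -> /set1P ->; apply: connect0.
      exists set0; first exact: elim_mem eL.
      by rewrite covL W0 big_set0 setI0.
    have /existsP[x xW] : [exists x, x \notin W].
      rewrite -negb_forall; apply: contraL nV => /forallP full.
      by rewrite -leqNgt -Wn; apply/subset_leq_card/subsetP => x _; apply: full.
    have [u [v [uW vW euv]]] := connect_exit syme wW xW (cone w x).
    exists v; split=> //; first exact: conn_in_add euv.
    have [C CL uC] := WL u uW; exists C => //; apply: subset_trans uC.
    rewrite covL; apply/subsetP => y /setIP[yv /bigcupP[w' w'W yw']].
    exact: (running_intersection tree conn cW uW vW euv w'W yw' yv).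
  have [L' [eL' sL' cL' exC']] := elim_add eL CL HC (betak v).
  exists (v |: W); split=> //; first by rewrite cardsU1 vW Wn.
  exists L'; split=> [//||w]; first by rewrite cL' covL big_setU1 //= setUC.
  rewrite in_setU1 => /predU1P[-> //|wW].
  by have [D DL wD] := WL w wW; exists D; rewrite ?sL'.
have [W [WV _ [L [eL _ WL]]]] := claim _ (leqnn _).
exists L; split=> // v; apply: WL.
have /eqP -> : W == setT by rewrite eqEcard subsetT cardsT WV leqnn.
by rewrite inE.
Qed.

(** A tree decomposition need not put an element lying in no constraint into any bag; such elements
    are added as singleton cliques over the empty base, which takes [0 < k]. *)
Lemma elim_full (Y : finType) k (L : seq {set Y}) :
  0 < k -> elim k set0 L ->
  exists L', [/\ elim k set0 L', {subset L <= L'} & cov L' = setT].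
Proof.
move=> k0; have [n] := ubnP #|~: cov L|; elim: n => // n IH in L * => len eL.
have [E0|/set0Pn[y yL]] := eqVneq (~: cov L) set0.
  by exists L; split=> //; rewrite -[cov L]setCK E0 setC0.
have [|||L1 [eL1 sL1 cL1 _]] := @elim_add _ k set0 L set0 [set y] eL.
- exact: elim_mem eL.
- by apply/subsetP => z; rewrite !inE => /andP[/eqP -> yc]; rewrite inE yc in yL.
- by rewrite cards1.
have [||L2 [eL2 sL2 cL2]] := IH L1.
- rewrite cL1; rewrite ltnS in len; apply: leq_trans len; apply: proper_card; apply/properP; split.
    by rewrite setCS subsetUl.
  by exists y => //; rewrite !inE eqxx orbT.
- exact: eL1.
by exists L2; split=> // C /sL1 /sL2.
Qed.
End Tree.

Lemma width_lt (V T : finType) (beta : V -> {set T}) (k : nat) :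
  (width beta < k%:Z)%R <-> forall v, #|beta v| <= k.
Proof.
rewrite /width ltrBlDr -[1%R]/(Posz 1) -PoszD ltz_nat addn1 ltnS.
by split=> [/bigmax_leqP H v|H]; [apply: H|apply/bigmax_leqP].
Qed.

Lemma bf_nhom sg k (A B : structure sg) (P : {set univ A * univ B} -> Prop) :
  0 < k -> bf_system k P ->
  forall X : structure sg, treewidth_lt X k -> nhom X A = nhom X B.
Proof.
move=> k0 bf X [V [e [beta [[tree cover conn] /width_lt betak]]]].
have [L0 [eL0 betaL0]] := tree_elim tree conn betak.
have [L [eL sL covL]] := elim_full k0 eL0.
have relL R (t : {ffun 'I_(ar R) -> univ X}) : t \in rels X R ->
    exists2 C, C \in L & forall i, t i \in C.
  move=> /cover[v tv]; have [C CL vC] := betaL0 v; exists C; first exact: sL.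
  by move=> i; apply: (subsetP vC).
apply/eqP; rewrite eqn_leq; apply/andP; split.
  exact: (nhom_leq k0 bf eL covL relL).
exact: (nhom_leq k0 (bf_sym bf) eL covL relL).
Qed.

(** * From homomorphism counts to systems *)

Section ParentTree.
Variables (V : finType) (r : V) (par : V -> V) (m : V -> nat).
Hypotheses (par_root : par r = r) (par_lt : forall v, v != r -> m (par v) < m v).

Definition parent_rel : rel V :=
  [rel u v | (u != v) && ((par u == v) || (par v == u))].

Lemma parent_rel_sym : symmetric parent_rel.
Proof. by move=> u v; rewrite /parent_rel /= eq_sym orbC. Qed.

Lemma parent_edge v : v != r -> parent_rel v (par v).
Proof.
move=> vr; rewrite /parent_rel /= eqxx andbT; apply: contraTneq (par_lt vr) => <-.
by rewrite ltnn.
Qed.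

(** On a cycle, a vertex with the largest value of [m] would have its parent as both of its
    neighbours. *)
Lemma parent_tree : is_tree parent_rel.
Proof.
have top v : connect parent_rel v r.
  have [n] := ubnP (m v); elim: n => // n IH in v *; rewrite ltnS => mv.
  have [->|vr] := eqVneq v r; first exact: connect0.
  apply: connect_trans (connect1 (parent_edge vr)) (IH _ _).
  exact: leq_trans (par_lt vr) mv.
split.
- by apply/card_gt0P; exists r.
- exact: parent_rel_sym.
- by move=> v; rewrite /parent_rel /= eqxx.
- move=> x y; apply: connect_trans (top x) _.
  by rewrite (sym_connect_sym parent_rel_sym).
move=> p uniq_p size_p; apply/negP => cycle_p.
have [v0 v0p] : exists v, v \in p by case: p size_p {uniq_p cycle_p} => // v p; exists v; rewrite inE eqxx.
case: (@arg_maxnP _ v0 (mem p) m v0p) => v vp vmax.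
have up w : w \in p -> parent_rel v w -> w = par v.
  move=> wp /andP[vw /orP[/eqP //|/eqP pw]]; have := vmax w wp.
  rewrite /= leqNgt -pw par_lt //; apply: contraNneq vw => wr.
  by rewrite -pw wr par_root.
have [i q rot_p] := rot_to vp.
have mem_q w : w \in v :: q -> w \in p by rewrite -rot_p mem_rot.
move: cycle_p uniq_p size_p; rewrite -(rot_cycle i) -(rot_uniq i) -(size_rot i) rot_p.
case: q mem_q {rot_p} => [|w [|z q]] // mem_q.
rewrite /cycle rcons_path /= => /andP[/and3P[vw _ _] zv] /and3P[_ wq _] _.
have ew : w = par v by apply: up vw; apply: mem_q; rewrite !inE eqxx orbT.
have ez : last z q = par v.
  apply: up; first by apply: mem_q; rewrite 2!in_cons mem_last !orbT.
  by rewrite parent_rel_sym.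
by move: wq; rewrite ew -ez mem_last.
Qed.

(** Here [top] stands for the highest node whose bag contains [y]; any two nodes with [y] in their
    bags are joined by climbing to it. *)
Lemma parent_connected (Y : finType) (bag : V -> {set Y}) (y : Y) (top : V) :
  (forall v, y \in bag v -> v != top -> v != r /\ y \in bag (par v)) ->
  forall v w, y \in bag v -> y \in bag w ->
    connect [rel a b | [&& parent_rel a b, y \in bag a & y \in bag b]] v w.
Proof.
move=> topP.
set e := [rel a b | [&& parent_rel a b, y \in bag a & y \in bag b]].
have syme : symmetric e.
  by move=> a b; rewrite /e /= -!/(parent_rel _ _) parent_rel_sym; congr (_ && _); rewrite andbC.
have totop v : y \in bag v -> connect e v top.
  have [n] := ubnP (m v); elim: n => // n IH in v *; rewrite ltnS => mv yv.
  have [->|vt] := eqVneq v top; first exact: connect0.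
  have [vr yp] := topP v yv vt.
  have epar : e v (par v) by rewrite /e /= yv yp !andbT; apply: parent_edge.
  apply: (@connect_trans _ e (par v)); first exact: connect1.
  by apply: IH yp; apply: leq_trans (par_lt vr) mv.
move=> v w yv yw; apply: connect_trans (totop v yv) _.
by rewrite (sym_connect_sym syme); apply: totop.
Qed.
End ParentTree.

Section BigFfun.
Variables (A U V : finType).

Lemma sum_ffun_option (F : {ffun option U -> A} -> nat) :
  \sum_h F h = \sum_a \sum_(h : {ffun U -> A})
    F [ffun o => if o is Some u then h u else a].
Proof.
rewrite pair_big /=; apply: reindex.
exists (fun h : {ffun option U -> A} => (h None, [ffun u => h (Some u)])) => [[a h]|h] _ /=.
  by congr (_, _); [rewrite ffunE|apply/ffunP => u; rewrite !ffunE].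
by apply/ffunP => -[u|]; rewrite !ffunE.
Qed.

Lemma sum_ffun_sum (F : {ffun U + V -> A} -> nat) :
  \sum_h F h = \sum_(h : {ffun U -> A}) \sum_(h' : {ffun V -> A})
    F [ffun o => match o with inl u => h u | inr v => h' v end].
Proof.
rewrite pair_big /=; apply: reindex.
exists (fun h : {ffun U + V -> A} => ([ffun u => h (inl u)], [ffun u => h (inr u)])) => [[h h']|h] _ /=.
  by congr (_, _); apply/ffunP => u; rewrite !ffunE.
by apply/ffunP => -[u|u]; rewrite !ffunE.
Qed.
End BigFfun.

(** * Marked structures of treewidth less than k as terms *)

Section Terms.
Variables (sg : signature) (k : nat).

(* Terms describe structures of treewidth < k together with a tree
   decomposition; TSum i pi t1 t2 hangs t1 below the root bag of t2 after
   forgetting the i-th marked element, taking a fresh one instead, and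
   re-marking along pi. *)
Inductive term : Type :=
| TOne
| TAtom (R : sym sg) (v : 'I_(ar R) -> 'I_k) (t : term)
| TSum (i : 'I_k) (pi : 'I_k -> 'I_k) (t1 t2 : term).

(** Glues two structures along their marks, which multiplies the counts. *)
Fixpoint tmul (t t' : term) : term :=
  match t with
  | TOne => t'
  | TAtom R v t1 => TAtom v (tmul t1 t')
  | TSum i pi t1 t2 => TSum i pi t1 (tmul t2 t')
  end.

(** The number of homomorphisms extending the placement [al] of the marks, as [tsat_count] confirms;
    the recursion is the usual dynamic programme over a tree decomposition. *)
Fixpoint tval (A : structure sg) (t : term) (al : 'I_k -> univ A) : nat :=
  match t with
  | TOne => 1
  | TAtom R v t1 => ([ffun i => al (v i)] \in rels A R) * tval t1 al
  | TSum i pi t1 t2 => (\sum_a tval t1 (upd al i a \o pi)) * tval t2 al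
  end.

Lemma tval_mul A t t' al : tval (A := A) (tmul t t') al = tval t al * tval t' al.
Proof.
elim: t => [|R v t IH|i pi t1 _ t2 IH] /=; first by rewrite mul1n.
  by rewrite IH mulnA.
by rewrite IH mulnA.
Qed.

Fixpoint tvar (t : term) : finType :=
  match t with
  | TOne => void
  | TAtom R v t1 => tvar t1
  | TSum i pi t1 t2 => (option (tvar t1) + tvar t2)%type
  end.

Definition atom (Y : finType) : finType := {R : sym sg & {ffun 'I_(ar R) -> Y}}.
Definition mkatom (Y : finType) R (t : {ffun 'I_(ar R) -> Y}) : atom Y :=
  existT (fun R : sym sg => {ffun 'I_(ar R) -> Y}) R t.
Definition map_atom (Y Z : finType) (h : Y -> Z) (c : atom Y) : atom Z :=
  mkatom [ffun i => h (tagged c i)].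
Definition holds (A : structure sg) (c : atom (univ A)) : bool :=
  tagged c \in rels A (tag c).

Fixpoint tatoms (Y : finType) (t : term) (l : 'I_k -> Y) : (tvar t -> Y) -> seq (atom Y) :=
  match t return (tvar t -> Y) -> _ with
  | TOne => fun _ => [::]
  | TAtom R v t1 => fun g =>
      mkatom [ffun i => l (v i)] :: @tatoms Y t1 l g
  | TSum i pi t1 t2 => fun g =>
      tatoms (upd l i (g (inl None)) \o pi) (fun u : tvar t1 => g (inl (Some u)))
      ++ tatoms l (fun u : tvar t2 => g (inr u))
  end.

Lemma upd_comp (Y Z : Type) (h : Y -> Z) (l : 'I_k -> Y) i c :
  h \o upd l i c = upd (h \o l) i (h c).
Proof. by apply/funext => j; rewrite /upd /=; case: eqP. Qed.

Lemma tatoms_map (Y Z : finType) (h : Y -> Z) t (l : 'I_k -> Y) (g : tvar t -> Y) :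
  tatoms (h \o l) (h \o g) = map (map_atom h) (tatoms l g).
Proof.
elim: t l g => [|R v t IH|i pi t1 IH1 t2 IH2] l g //=.
  rewrite -IH; congr (mkatom _ :: _).
  by apply/ffunP => i; rewrite !ffunE.
by rewrite map_cat -IH1 -IH2 compA upd_comp.
Qed.

Definition tsat (A : structure sg) t (al : 'I_k -> univ A) (h : tvar t -> univ A) :=
  all (@holds A) (tatoms al h).

Lemma tsat_count A t al :
  \sum_(h : {ffun tvar t -> univ A}) tsat al h = tval t al.
Proof.
elim: t al => [|R v t IH|i pi t1 IH1 t2 IH2] al /=.
- rewrite (eq_bigr (fun=> 1)) // sum1_card card_ffun card_void expn0 //.
- rewrite -IH big_distrr /=; apply: eq_bigr => h _.
  by rewrite /tsat /= -mulnb.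
- rewrite sum_ffun_sum sum_ffun_option.
  rewrite -IH2 big_distrl /=; apply: eq_bigr => a _.
  rewrite -IH1 big_distrl /=; apply: eq_bigr => h1 _.
  rewrite big_distrr /=; apply: eq_bigr => h2 _.
  rewrite /tsat /= all_cat mulnb; rewrite !ffunE.
  congr (nat_of_bool (_ && _)); congr (all _ (tatoms _ _));
  by apply/funext => u; rewrite !ffunE.
Qed.

(** All marks are identified to the one element [None], so a homomorphism count becomes the sum of
    [tval] over constant assignments. *)
Definition tstruct (t : term) : structure sg :=
  @MkStructure sg (option (tvar t))
    (fun R => [set tp | mkatom tp \in tatoms (fun=> None) (@Some (tvar t))]).

Lemma nhom_tstruct t A : nhom (tstruct t) A = \sum_a tval (A := A) t (fun=> a).
Proof.
rewrite /nhom -sum1dep_card big_mkcond sum_ffun_option; apply: eq_bigr => a _.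
rewrite -tsat_count; apply: eq_bigr => h _.
set h' := finfun _.
have -> : tsat (fun=> a) h = tsat (h' \o (fun=> None)) (h' \o Some).
  congr (tsat _ _); first by apply/funext => x; rewrite /= ffunE.
  by apply/funext => u; rewrite /= ffunE.
rewrite /tsat tatoms_map all_map.
have -> : is_hom (tstruct t) A h' =
    all (preim (map_atom h') (@holds A)) (tatoms (fun=> None) (@Some (tvar t))).
  apply/forallP/allP => [H [R tp] ctp|H R] /=.
    by have /forallP/(_ tp)/implyP := H R; apply; rewrite inE.
  by apply/forallP => tp; apply/implyP; rewrite inE => /H.
by case: all.
Qed.

Fixpoint tnode (t : term) : finType :=
  match t with
  | TOne => unit
  | TAtom R v t1 => tnode t1
  | TSum i pi t1 t2 => (tnode t1 + tnode t2)%type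
  end.

Fixpoint troot (t : term) : tnode t :=
  match t with
  | TOne => tt
  | TAtom R v t1 => troot t1
  | TSum i pi t1 t2 => inr (troot t2)
  end.

Fixpoint tpar (t : term) : tnode t -> tnode t :=
  match t with
  | TOne => fun v => v
  | TAtom R v t1 => @tpar t1
  | TSum i pi t1 t2 => fun v =>
      match v with
      | inl v => if v == troot t1 then inr (troot t2) else inl (tpar v)
      | inr v => inr (tpar v)
      end
  end.

Fixpoint tdepth (t : term) : tnode t -> nat :=
  match t with
  | TOne => fun _ => 0
  | TAtom R v t1 => @tdepth t1
  | TSum i pi t1 t2 => fun v =>
      match v with inl v => (tdepth v).+1 | inr v => tdepth v end
  end.

(** A bag consists of the elements marked at its node, hence has at most [k] elements, and fewer
    when marks coincide. *)
Fixpoint tbag (Y : finType) (t : term) (l : 'I_k -> Y) :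
    (tvar t -> Y) -> tnode t -> {set Y} :=
  match t return (tvar t -> Y) -> tnode t -> {set Y} with
  | TOne => fun _ _ => [set l x | x : 'I_k]
  | TAtom R v t1 => @tbag Y t1 l
  | TSum i pi t1 t2 => fun g v =>
      match v with
      | inl v => tbag (upd l i (g (inl None)) \o pi) (fun u : tvar t1 => g (inl (Some u))) v
      | inr v => tbag l (fun u : tvar t2 => g (inr u)) v
      end
  end.

Lemma tdepth_root t : tdepth (troot t) = 0.
Proof. by elim: t. Qed.

Lemma tpar_root t : tpar (troot t) = troot t.
Proof. by elim: t => //= i pi t1 _ t2 ->. Qed.

Lemma tpar_lt t (v : tnode t) : v != troot t -> tdepth (tpar v) < tdepth v.
Proof.
elim: t v => [|R v t IH|i pi t1 IH1 t2 IH2] /=; first by case.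
  exact: IH.
case=> v vr; last exact: IH2.
by case: eqP => [_|/eqP /IH1 //]; rewrite tdepth_root.
Qed.

Lemma tbag_root (Y : finType) t (l : 'I_k -> Y) (g : tvar t -> Y) :
  tbag l g (troot t) = [set l x | x : 'I_k].
Proof. by elim: t l g => //= i pi t1 _ t2 IH l g; apply: IH. Qed.

Lemma card_tbag (Y : finType) t (l : 'I_k -> Y) (g : tvar t -> Y) v :
  #|tbag l g v| <= k.
Proof.
elim: t l g v => [|R w t IH|i pi t1 IH1 t2 IH2] l g v /=; last by case: v.
  by apply: leq_trans (leq_imset_card _ _) _; rewrite card_ord.
exact: IH.
Qed.

Lemma tbag_im (Y : finType) t (l : 'I_k -> Y) (g : tvar t -> Y) v y :
  y \in tbag l g v -> (exists x, y = l x) \/ (exists u, y = g u).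
Proof.
elim: t l g v => [|R w t IH|i pi t1 IH1 t2 IH2] l g v /=.
- by move=> /imsetP[x _ ->]; left; exists x.
- exact: IH.
- case: v => v; first case/IH1 => [[x ->]|[u ->]].
  + rewrite /= /upd; case: eqP => _; first by right; exists (inl None).
    by left; exists (pi x).
  + by right; exists (inl (Some u)).
  + case/IH2 => [[x ->]|[u ->]]; first by left; exists x.
    by right; exists (inr u).
Qed.

(** Labels may coincide with one another, because [pi] can repeat a mark and [tstruct] merges all of
    them; only the variables must be distinct and differ from the labels. *)
Definition fresh (Y : finType) t (l : 'I_k -> Y) (g : tvar t -> Y) : Prop :=
  injective g /\ forall x u, l x <> g u.

Lemma fresh_left (Y : finType) i pi t1 t2 (l : 'I_k -> Y) (g : tvar (TSum i pi t1 t2) -> Y) :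
  fresh l g ->
  fresh (upd l i (g (inl None)) \o pi) (fun u : tvar t1 => g (inl (Some u))).
Proof.
move=> [ginj disj]; split=> [u u' /ginj[] //|x u] /=.
by rewrite /upd; case: eqP => [_ /ginj|_ /disj].
Qed.

Lemma fresh_right (Y : finType) i pi t1 t2 (l : 'I_k -> Y) (g : tvar (TSum i pi t1 t2) -> Y) :
  fresh l g -> fresh l (fun u : tvar t2 => g (inr u)).
Proof. by move=> [ginj disj]; split=> [u u' /ginj[]|x u /disj]. Qed.

Lemma tbag_marked (Y : finType) t (l : 'I_k -> Y) (g : tvar t -> Y) x v :
  fresh l g -> l x \in tbag l g v -> v != troot t -> l x \in tbag l g (tpar v).
Proof.
elim: t l g x v => [|R w t IH|i pi t1 IH1 t2 IH2] l g x v fr /=.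
- by case: v.
- exact: IH.
- case: v => v; last by move=> xv vr; apply: IH2 xv vr; apply: fresh_right fr.
  move=> xv _; case: eqP => [_|/eqP vr].
    by rewrite tbag_root; apply: imset_f.
  have fr1 := fresh_left fr.
  case: (tbag_im xv) => [[z ez]|[u /(fr.2 _ _)] //].
  by rewrite ez in xv *; apply: IH1.
Qed.

(** At a [TSum], a marked [y] has the root as its highest node. A variable of [t2] occurs in no bag
    of [t1], and its highest node is found in [t2]; any other element can only occur in bags of
    [t1]. *)
Lemma tbag_top (Y : finType) t (l : 'I_k -> Y) (g : tvar t -> Y) y :
  fresh l g -> exists top, forall v, y \in tbag l g v -> v != top ->
    v != troot t /\ y \in tbag l g (tpar v).
Proof.
elim: t l g => [|R w t IH|i pi t1 IH1 t2 IH2] l g fr; first by exists tt; case.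
  exact: IH.
have [/existsP[x /eqP ->]|nol] := boolP [exists x, y == l x].
  exists (troot (TSum i pi t1 t2)) => v xv vr; split=> //; exact: tbag_marked.
have {}nol x : y <> l x by move=> e; case/existsP: nol; exists x; apply/eqP.
have fr1 := fresh_left fr; have fr2 := fresh_right fr.
have [/existsP[u /eqP yu]|nog] := boolP [exists u : tvar t2, y == g (inr u)].
  have [top topP] := IH2 _ _ fr2; exists (inr top) => -[v yv|v yv vt] /=.
    have [ginj disj] := fr.
    have := @tbag_im _ t1 _ _ v y yv; rewrite yu => -[[x]|[u' /ginj //]].
    by rewrite /= /upd; case: eqP => [_ /ginj //|_ /esym/disj].
  by have [? ?] := topP v yv vt.
have [top topP] := IH1 _ _ fr1; exists (inl top) => -[v yv vt|v yv] /=.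
  by have [vr yp] := topP v yv vt; rewrite (negbTE vr).
case: (@tbag_im _ t2 _ _ v y yv) => [[x /nol] //|[u yu]].
by case/existsP: nog; exists u; apply/eqP.
Qed.

Lemma tatoms_bag (Y : finType) t (l : 'I_k -> Y) (g : tvar t -> Y) c :
  c \in tatoms l g -> exists v, forall i, tagged c i \in tbag l g v.
Proof.
elim: t l g => [|R w t IH|i pi t1 IH1 t2 IH2] l g //=.
  rewrite inE => /predU1P[->|]; last exact: IH.
  by exists (troot t) => i; rewrite tbag_root ffunE imset_f.
rewrite mem_cat => /orP[/IH1[v vP]|/IH2[v vP]]; first by exists (inl v).
by exists (inr v).
Qed.

Lemma treewidth_tstruct t : treewidth_lt (tstruct t) k.
Proof.
exists (tnode t), (parent_rel (@tpar t)), (tbag (fun=> None) (@Some (tvar t))).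
split; last by apply/width_lt => v; apply: card_tbag.
have par_lt := @tpar_lt t; split.
- exact: parent_tree (tpar_root t) par_lt.
- by move=> R tp; rewrite inE => /tatoms_bag.
- move=> y v w yv yw.
  have fr : fresh (fun=> None) (@Some (tvar t)) by split=> // u u' [].
  have [top topP] := tbag_top y fr.
  exact: (parent_connected par_lt topP yv yw).
Qed.

Definition same_tests (A B : structure sg) (al : 'I_k -> univ A)
    (be : 'I_k -> univ B) : Prop :=
  (forall x y, (al x == al y) = (be x == be y)) /\
  forall t, tval t al = tval t be.

(** * Equal homomorphism counts give a system *)

Section HomToBf.
Variables (A B : structure sg).
Hypotheses (k0 : 0 < k)
  (hom_eq : forall X : structure sg, treewidth_lt X k -> nhom X A = nhom X B).

Lemma tval_sum t : \sum_a tval (A := A) t (fun=> a) = \sum_b tval (A := B) t (fun=> b).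
Proof. by rewrite -!nhom_tstruct; apply: hom_eq; apply: treewidth_tstruct. Qed.

Lemma hom_card : #|univ A| = #|univ B|.
Proof. by have := tval_sum TOne; rewrite /= !sum1_card. Qed.

Lemma sum_natr (I : finType) (F : I -> nat) :
  (\sum_i (F i)%:R = (\sum_i F i)%:R :> int)%R.
Proof. by rewrite natr_sum. Qed.

(** Closed structures control only constant assignments; interpolation over these gives the
    bijection for the empty position, from which single marks are moved later. *)
Lemma hom_start : exists f : univ A -> univ B, bijective f /\
  forall a, same_tests (fun=> a) (fun=> f a).
Proof.
pose ev t (w : univ A + univ B) : int :=
  (match w with inl a => tval t (fun=> a) | inr b => tval t (fun=> b) end)%:R%R.
have [||t|f [fbij fP]] := @test_bijection _ _ term TOne tmul ev.
- by case.
- by move=> t t' [x|x]; rewrite /ev tval_mul natrM.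
- by rewrite /ev !sum_natr tval_sum.
exists f; split=> // a; split=> [x y|t]; first by rewrite !eqxx.
by have /eqP := fP a t; rewrite eqr_nat => /eqP.
Qed.

(* A test is a term together with a set of marks that the new element is
   required to equal; terms alone cannot express equalities. *)
Lemma hom_forth (al : 'I_k -> univ A) (be : 'I_k -> univ B) i :
  same_tests al be -> exists f : univ A -> univ B, bijective f /\
    forall a, same_tests (upd al i a) (upd be i (f a)).
Proof.
move=> [eq_same val_same].
(* Re-marking along [upd id i j] overwrites mark [i] by mark [j] and drops the summed element, so
   the sum consists of as many equal terms as the universe has elements; the universes have the same
   nonzero size, which cancels. *)
have copy t j : j != i -> tval t (upd al i (al j)) = tval t (upd be i (be j)).
  move=> ji.
  have E (C : structure sg) (ga : 'I_k -> univ C) :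
      #|univ C| * tval t (upd ga i (ga j)) =
      tval (TSum i (upd id i j) t TOne) ga.
    rewrite /= muln1 -sum_nat_const; apply: eq_bigr => c _; congr (tval t _).
    apply/funext => x; rewrite /= /upd; case: (eqVneq x i) => [_|xi].
      by rewrite (negbTE ji).
    by rewrite (negbTE xi).
  have A0 : 0 < #|univ A| by apply/card_gt0P; exists (al i).
  apply/eqP; rewrite -(eqn_pmul2l A0); apply/eqP.
  by rewrite E val_same -E hom_card.
pose on (C : structure sg) (ga : 'I_k -> univ C) (J : {set 'I_k}) c :=
  [forall j in J, (j == i) || (ga j == c)].
have onU C ga J J' c : @on C ga (J :|: J') c = on C ga J c && on C ga J' c.
  apply/forall_inP/andP => [H|[/forall_inP H /forall_inP H'] j]; last first.
    by rewrite inE => /orP[/H|/H'].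
  by split; apply/forall_inP => j Jj; apply: H; rewrite inE Jj ?orbT.
pose ev (x : term * {set 'I_k}) (w : univ A + univ B) : int :=
  (match w with
   | inl a => on A al x.2 a * tval x.1 (upd al i a)
   | inr b => on B be x.2 b * tval x.1 (upd be i b) end)%:R%R.
have [w|x y w|[t J]|f [fbij fP]] := @test_bijection _ _ (term * {set 'I_k})%type
    (TOne, set0) (fun x y => (tmul x.1 y.1, x.2 :|: y.2)) ev.
- have on0 C ga c : on C ga set0 c by apply/forall_inP => j; rewrite inE.
  by case: w => c; rewrite /ev /= on0.
- by case: w => c; rewrite /ev /= -natrM onU tval_mul mulnACA -mulnb.
- rewrite /ev !sum_natr /=; congr (_%:R)%R.
  (* A mark [j] of [J] other than [i] forces the new element and collapses the sum to the one term
     treated by [copy]. Otherwise [J] imposes nothing and the sum is the value of a [TSum]. *)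
  have [/existsP[j /andP[jJ ji]]|none] := boolP [exists j, (j \in J) && (j != i)].
    have E (C : structure sg) (ga : 'I_k -> univ C) :
        \sum_c on C ga J c * tval t (upd ga i c) =
        on C ga J (ga j) * tval t (upd ga i (ga j)).
      rewrite (bigD1 (ga j)) //= big1 ?addn0 // => c cj.
      have /negbTE -> : ~~ on C ga J c.
        apply: contra cj => /forall_inP/(_ j jJ).
        by rewrite (negbTE ji) /= eq_sym.
      by rewrite mul0n.
    rewrite !E copy //; congr (_ * _); congr nat_of_bool.
    by apply: eq_forallb_in => j' _; rewrite eq_same.
  have onT C ga c : on C ga J c.
    apply/forall_inP => j jJ; apply: contraR none; rewrite negb_or => /andP[ji _].
    by apply/existsP; exists j; rewrite jJ.
  under eq_bigr do rewrite onT mul1n; under [RHS]eq_bigr do rewrite onT mul1n.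
  by have := val_same (TSum i id t TOne); rewrite /= !muln1.
exists f; split=> // a; split=> [|t]; last first.
  have /eqP := fP a (t, set0); rewrite eqr_nat => /eqP /=.
  have on0 C ga c : on C ga set0 c by apply/forall_inP => j; rewrite inE.
  by rewrite !on0 !mul1n.
have eqa j : j != i -> (al j == a) = (be j == f a).
  move=> ji; have /eqP := fP a (TOne, [set j]); rewrite eqr_nat /= !muln1.
  have on1 C ga c : on C ga [set j] c = (ga j == c).
    apply/forall_inP/idP => [/(_ j (set11 j))|e j' /set1P ->]; last by rewrite e orbT.
    by rewrite (negbTE ji).
  by rewrite !on1; case: (al j == a); case: (be j == f a).
move=> x y; rewrite /upd.
case: (eqVneq x i) => [_|xi]; case: (eqVneq y i) => [_|yi]; rewrite ?eqxx ?eqa ?eq_same //.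
by rewrite eq_sym eqa // eq_sym.
Qed.

Lemma hom_bf : exists P, bf_system k (A := A) (B := B) P.
Proof.
exists (fun p : {set univ A * univ B} => p = set0 \/ exists al be,
  p \subset pebs setT (Some \o al) (Some \o be) /\ same_tests al be); split.
- by left.
- move=> p q qp [p0|[al [be [pab same]]]].
    by left; apply/eqP; rewrite -subset0 -p0.
  by right; exists al, be; split=> //; apply: subset_trans pab.
- move=> p [->|[al [be [/subsetP pab [eq_same val_same]]]]].
    split=> [a b b'|a a' b|R t u tu]; rewrite ?inE //.
    (* Arities are positive, so no constraint lies inside the empty position. *)
    by have := tu (Ordinal (ar_pos R)); rewrite inE.
  have sub a b : (a, b) \in p -> exists i, al i = a /\ be i = b.
    by move=> /pab/pebsP[i _ [[<-] [<-]]]; exists i.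
  split.
  + move=> a b b' /sub[i [<- <-]] /sub[j [ji <-]].
    by apply/eqP; rewrite -eq_same ji.
  + move=> a a' b /sub[i [<- <-]] /sub[j [<- ji]].
    by apply/eqP; rewrite eq_same ji.
  + move=> R t u tu; have [v vP] := fin_all_exists (fun i => sub _ _ (tu i)).
    have := val_same (TAtom v TOne); rewrite /= !muln1.
    have -> : [ffun i => al (v i)] = t by apply/ffunP => i; rewrite ffunE; case: (vP i).
    have -> : [ffun i => be (v i)] = u by apply/ffunP => i; rewrite ffunE; case: (vP i).
    by case: (t \in _); case: (u \in _).
- move=> p [->|[al [be [pab same]]]] pk.
    have [f [fbij fP]] := hom_start; exists f; split=> // a; right.
    exists (fun=> a), (fun=> f a); split=> //; rewrite setU0 sub1set.
    by apply/pebsP; exists (Ordinal k0).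
  have [i pi] := pebs_free pab pk.
  have [f [fbij fP]] := hom_forth i same; exists f; split=> // a; right.
  exists (upd al i a), (upd be i (f a)); split=> //.
  by rewrite !upd_comp pebs_upd; apply: setUS.
Qed.
End HomToBf.
End Terms.

(** * Colour refinement *)

Section Refinement.
Variable sg : signature.
Implicit Types S : structure sg.

Definition mkc S (s : sym sg) (t : {ffun 'I_(ar s) -> univ S}) : cdata S :=
  existT (fun R : sym sg => {ffun 'I_(ar R) -> univ S}) s t.

Definition cvert S (s : sym sg) (t : {ffun 'I_(ar s) -> univ S})
  (ts : t \in rels S s) : constr S := exist _ (mkc t) ts.

Lemma mkc_inj S (s : sym sg) : injective (@mkc S s).
Proof. by move=> t t' /eqP; rewrite eq_Tagged => /eqP. Qed.

Lemma fvert_inj S s (t : {ffun 'I_(ar s) -> univ S}) (ts : t \in rels S s)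
    s' (t' : {ffun 'I_(ar s') -> univ S}) (ts' : t' \in rels S s') :
  inr (cvert ts) = inr (cvert ts') :> fvert S -> mkc t = mkc t'.
Proof.
pose get (v : fvert S) := if v is inr c then val c else mkc t.
by move/(congr1 get).
Qed.

Lemma cvertP S (c : constr S) :
  exists s t (ts : t \in rels S s), c = cvert ts.
Proof. by case: c => -[s t] ts; exists s, t, ts. Qed.

Lemma elabel_inv S S' (x : univ S) (y : univ S') s
    (t : {ffun 'I_(ar s) -> univ S}) (ts : t \in rels S s) (d : constr S') :
  elabel x (cvert ts) = elabel y d ->
  exists u (us : u \in rels S' s), d = cvert us /\ forall m, (t m == x) = (u m == y).
Proof.
case: d => -[s' u] us; rewrite /elabel /= => e.
have es : s = s' := congr1 tag e; subst s'.
exists u, us; split=> // m.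
by move/eqP: e; rewrite eq_Tagged => /eqP/setP/(_ m); rewrite !inE.
Qed.

Lemma elabel_eq S S' (x : univ S) (y : univ S') s
    (t : {ffun 'I_(ar s) -> univ S}) (ts : t \in rels S s)
    (u : {ffun 'I_(ar s) -> univ S'}) (us : u \in rels S' s) :
  (forall m, (t m == x) = (u m == y)) -> elabel x (cvert ts) = elabel y (cvert us).
Proof.
move=> e; rewrite /elabel /=; congr existT.
by apply/setP => m; rewrite !inE e.
Qed.

Lemma nbr_elt S (x : univ S) v :
  v \in nbr (inl x) <->
  exists s t (ts : t \in rels S s) m, v = inr (cvert ts) /\ t m = x.
Proof.
rewrite inE; case: v => [a|c] /=; first by split=> // -[s [t [ts [m []]]]].
split=> [/existsP[m /eqP e]|[s [t [ts [m [[->] e]]]]]]; last by apply/existsP; exists m; apply/eqP.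
have [s [t [ts ec]]] := cvertP c; subst c.
by exists s, t, ts, m.
Qed.

Lemma nbr_constr S s (t : {ffun 'I_(ar s) -> univ S}) (ts : t \in rels S s) v :
  v \in nbr (inr (cvert ts)) <-> exists m, v = inl (t m).
Proof.
rewrite inE; case: v => [a|c] /=; last by split=> // -[].
split=> [/existsP[m /eqP <-]|[m [->]]]; first by exists m.
by apply/existsP; exists m.
Qed.

(** One half of a colour-preserving correspondence, asking for injections only, since these are what
    transport along a system provides; the other half comes from the converse relation. Through
    [sim_eq] the edge labels, which record the positions of an element, agree. *)
Record half_sim S S' (sim : univ S -> univ S' -> Prop) : Prop := HalfSim {
  sim_inj : exists f : univ S -> univ S', injective f /\ forall x, sim x (f x);
  sim_nbr : forall x y, sim x y -> forall s (m : 'I_(ar s)),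
    exists f : {ffun 'I_(ar s) -> univ S} -> {ffun 'I_(ar s) -> univ S'},
      {in [pred t in rels S s | t m == x] &, injective f} /\
      forall t, t \in rels S s -> t m = x ->
        [/\ f t \in rels S' s, f t m = y & forall m', sim (t m') (f t m')];
  sim_eq : forall s (t : {ffun 'I_(ar s) -> univ S}) (u : {ffun 'I_(ar s) -> univ S'}),
    t \in rels S s -> u \in rels S' s -> (forall m, sim (t m) (u m)) ->
    forall m m', (t m == t m') = (u m == u m') }.

Definition fsim S S' (sim : univ S -> univ S' -> Prop) (v : fvert S) (w : fvert S') : Prop :=
  match v, w with
  | inl x, inl y => sim x y
  | inr c, inr d => exists s t u (ts : t \in rels S s) (us : u \in rels S' s),
      [/\ c = cvert ts, d = cvert us & forall m, sim (t m) (u m)]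
  | _, _ => False
  end.

Lemma fsim_flip S S' (sim : univ S -> univ S' -> Prop) v w :
  fsim sim v w -> fsim (fun y x => sim x y) w v.
Proof.
case: v w => [x|c] [y|d] //= [s [t [u [ts [us [-> -> h]]]]]].
by exists s, u, t, us, ts.
Qed.

(** A constraint is sent along the neighbourhood injection of its first entry. This is injective
    because the image determines the first entry through [f0], and then the constraint among those
    with that first entry. *)
Lemma fsim_inj S S' (sim : univ S -> univ S' -> Prop) :
  half_sim sim -> exists f : fvert S -> fvert S', injective f /\ forall v, fsim sim v (f v).
Proof.
move=> hs; have [f0 [inj0 sim0]] := sim_inj hs.
have [Phi PhiP] := fin_all_exists (fun x => fin_all_exists (fun s => fin_all_exists (sim_nbr hs (sim0 x) (s := s)))).
pose m0 (s : sym sg) := Ordinal (ar_pos s : 0 < ar s).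
pose psi (s : sym sg) (t : {ffun 'I_(ar s) -> univ S}) := Phi (t (m0 s)) s (m0 s) t.
have psi_in s t : t \in rels S s -> psi s t \in rels S' s.
  by move=> ts; have [_ /(_ t ts erefl)[]] := PhiP (t (m0 s)) s (m0 s).
have psi_0 s t : t \in rels S s -> psi s t (m0 s) = f0 (t (m0 s)).
  by move=> ts; have [_ /(_ t ts erefl)[]] := PhiP (t (m0 s)) s (m0 s).
have psi_sim s t : t \in rels S s -> forall m, sim (t m) (psi s t m).
  by move=> ts; have [_ /(_ t ts erefl)[]] := PhiP (t (m0 s)) s (m0 s).
have psi_inj s : {in rels S s &, injective (psi s)}.
  move=> t t' ts ts' e.
  have e0 : t (m0 s) = t' (m0 s) by apply: inj0; rewrite -!psi_0 // e.
  have [+ _] := PhiP (t (m0 s)) s (m0 s); apply; rewrite ?inE ?ts ?ts' ?e0 ?eqxx //.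
  by move: e; rewrite /psi e0.
pose f (v : fvert S) : fvert S' :=
  match v with
  | inl x => inl (f0 x)
  | inr c => inr (cvert (psi_in (tag (val c)) (tagged (val c)) (valP c)))
  end.
have fE s t (ts : t \in rels S s) : f (inr (cvert ts)) = inr (cvert (psi_in s t ts)).
  by congr inr; apply: val_inj.
exists f; split=> [[x|c] [x'|c'] //|[x|c]].
- by move=> [/inj0 ->].
- have [s [t [ts ->]]] := cvertP c; have [s' [t' [ts' ->]]] := cvertP c'.
  rewrite !fE => /fvert_inj e; have es : s = s' := congr1 tag e; subst s'.
  by congr inr; apply: val_inj => /=; congr mkc; apply: psi_inj => //; apply: mkc_inj.
- exact: sim0.
- have [s [t [ts ->]]] := cvertP c; rewrite fE.
  by exists s, t, (psi s t), ts, (psi_in s t ts); split=> // m; apply: psi_sim.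
Qed.

(** An element can occur in a constraint at several positions, and each position has its own
    injection. One occurrence is picked; constraints with the same image have the same occurrence
    set by [sim_eq], hence the same picked position. *)
Lemma fsim_nbr S S' (sim : univ S -> univ S' -> Prop) v w :
  half_sim sim -> fsim sim v w ->
  exists f : fvert S -> fvert S',
    {in nbr v &, injective f} /\
    forall u, u \in nbr v ->
      [/\ f u \in nbr w, flabel v u = flabel w (f u) & fsim sim u (f u)].
Proof.
move=> hs; case: v w => [x|c] [y|d] //= vw.
  have [Phi PhiP] := fin_all_exists (fun s => fin_all_exists (sim_nbr hs vw (s := s))).
  pose f (v : fvert S) : fvert S' :=
    if v isn't inr c then inl y else
    if [pick m | tagged (val c) m == x] isn't Some m then inl y else
    if insub (mkc (Phi (tag (val c)) m (tagged (val c)))) is Some d then inr d else inl y.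
  have fE v : v \in nbr (inl x) -> exists s t (ts : t \in rels S s) m
      (us : Phi s m t \in rels S' s), [/\ v = inr (cvert ts), t m = x,
        [pick m | t m == x] = Some m & f v = inr (cvert us)].
    case/nbr_elt=> s [t [ts [m0 [-> tm0]]]]; exists s, t, ts.
    case e: [pick m | t m == x] => [m|]; last first.
      by move: e; case: pickP => // /(_ m0); rewrite tm0 eqxx.
    have tm : t m = x by move: e; case: pickP => // m' /eqP tm' [<-].
    have [_ /(_ t ts tm)[us _ _]] := PhiP s m; exists m, us; split=> //.
    rewrite /f /= e insubT; congr inr; exact: val_inj.
  have labE s t (ts : t \in rels S s) m (us : Phi s m t \in rels S' s) :
      t m = x -> forall m', (t m' == x) = (Phi s m t m' == y).
    move=> tm m'; have [_ /(_ t ts tm)[_ um ut]] := PhiP s m.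
    by rewrite -{1}tm -um; apply: (sim_eq hs ts us ut).
  exists f; split=> [v v' /fE[s [t [ts [m [us [-> tm pm ->]]]]]]|v].
    case/fE=> s' [t' [ts' [m' [us' [-> tm' pm' ->]]]]] /fvert_inj e.
    have es : s = s' := congr1 tag e; subst s'; have {}e := mkc_inj e.
    have em : m = m'.
      apply: Some_inj; rewrite -pm -pm'; apply: eq_pick => j /=.
      by rewrite (labE _ _ ts _ us tm) e (labE _ _ ts' _ us' tm').
    subst m'; congr inr; apply: val_inj => /=; congr mkc.
    by have [+ _] := PhiP s m; apply; rewrite // inE ?ts ?ts' ?tm ?tm' eqxx.
  case/fE=> s [t [ts [m [us [-> tm pm ->]]]]].
  have [_ /(_ t ts tm)[_ um ut]] := PhiP s m; split.
  - by apply/nbr_elt; exists s, (Phi s m t), us, m.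
  - by congr Some; apply: elabel_eq; apply: labE.
  - by exists s, t, (Phi s m t), ts, us.
case: vw => s [t [u [ts [us [-> -> tu]]]]].
have teq := sim_eq hs ts us tu.
pose f (v : fvert S) : fvert S' :=
  if v isn't inl x then inr (cvert us) else
  if [pick m | t m == x] is Some m then inl (u m) else inr (cvert us).
have fE m : f (inl (t m)) = inl (u m).
  rewrite /f; case: pickP => [m' /eqP e|/(_ m)]; last by rewrite eqxx.
  by congr inl; apply/eqP; rewrite -teq e.
exists f; split=> [v v' /nbr_constr[m ->] /nbr_constr[m' ->]|v /nbr_constr[m ->]].
  by rewrite !fE => -[/eqP]; rewrite -teq => /eqP ->.
rewrite fE; split=> //; first by apply/nbr_constr; exists m.
by congr Some; apply: elabel_eq => m'.
Qed.

Lemma fsim_nbr_bij S S' (sim : univ S -> univ S' -> Prop) v w :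
  half_sim sim -> half_sim (fun y x => sim x y) -> fsim sim v w ->
  exists f : fvert S -> fvert S',
    [/\ {in nbr v &, injective f}, f @: nbr v = nbr w &
      forall u, u \in nbr v -> flabel v u = flabel w (f u) /\ fsim sim u (f u)].
Proof.
move=> hs hs' vw; have [f [finj fP]] := fsim_nbr hs vw.
have [g [ginj gP]] := fsim_nbr hs' (fsim_flip vw).
exists f; split=> // [|u uv]; last by have [_ ? ?] := fP u uv.
apply/eqP; rewrite eqEcard; apply/andP; split.
  by apply/subsetP => _ /imsetP[u uv ->]; have [] := fP u uv.
rewrite (card_in_imset finj) -(card_in_imset ginj); apply/subset_leq_card/subsetP.
by move=> _ /imsetP[u uw ->]; have [] := gP u uw.
Qed.

Lemma half_sim_equiv1 S S' (sim : univ S -> univ S' -> Prop) :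
  half_sim sim -> half_sim (fun y x => sim x y) -> equiv1 S S'.
Proof.
move=> hs hs'; have [f [finj fP]] := fsim_inj hs; have [g [ginj _]] := fsim_inj hs'.
exists f; split=> [|j v]; first by apply: inj_card_bij finj _; apply: leq_card ginj.
elim: j v (f v) (fP v) => [|j IH] v w; first by case: v w => [x|c] [y|d].
move=> /(fsim_nbr_bij hs hs')[h [hinj him hP]]; exists h; split=> // u /hP[lab sim_u].
by split=> //; apply: IH.
Qed.

Lemma same_delta_sym S S' j (v : fvert S) (w : fvert S') :
  same_delta j v w -> same_delta j w v.
Proof.
elim: j v w => [|j IH] v w /=; first by move->.
move=> [f [finj fim fP]].
pose g w' := odflt v [pick v' in nbr v | f v' == w'].
have gf v' : v' \in nbr v -> g (f v') = v'.
  move=> vv; rewrite /g; case: pickP => [v2 /andP[vv2 /eqP]|/(_ v')]; first exact: finj.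
  by rewrite vv eqxx.
exists g; rewrite -fim; split.
- by move=> _ _ /imsetP[u uv ->] /imsetP[u' uv' ->]; rewrite !gf // => ->.
- apply/setP => u; apply/imsetP/idP => [[_ /imsetP[u' uv' ->] ->]|uv]; first by rewrite gf.
  by exists (f u); rewrite ?imset_f ?gf.
- move=> _ /imsetP[u uv ->]; rewrite gf //; have [e d] := fP u uv.
  by split=> //; apply: IH.
Qed.

Definition stab S S' (v : fvert S) (w : fvert S') : Prop := forall j, same_delta j v w.

Lemma stab_sym S S' (v : fvert S) (w : fvert S') : stab v w -> stab w v.
Proof. by move=> vw j; apply: same_delta_sym. Qed.

Lemma equiv1_sym S S' : equiv1 S S' -> equiv1 S' S.
Proof.
move=> [f [[g fg gf] fP]]; exists g; split=> [|j v]; first by exists f.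
by apply: same_delta_sym; rewrite -{2}[v]gf; apply: fP.
Qed.

Lemma nbr_kind S (v u : fvert S) : u \in nbr v -> kind u = ~~ kind v.
Proof. by rewrite inE; case: v u => [x|c] [y|d]. Qed.

Lemma nbr0_kind S (v : fvert S) : nbr v = set0 -> kind v.
Proof.
case: v => // c; have [s [t [ts ->]]] := cvertP c => /setP/(_ (inl (t (Ordinal (ar_pos s))))).
rewrite [in RHS]inE => /negP[]; apply/nbr_constr; by eexists.
Qed.

(** The base case recovers the kind of a vertex: neighbours have the opposite kind, and a vertex
    without neighbours is an element because arities are positive. *)
Lemma same_delta_pred S S' j (v : fvert S) (w : fvert S') :
  same_delta j.+1 v w -> same_delta j v w.
Proof.
elim: j v w => [|j IH] v w [f [finj fim fP]].
  have [v0|/set0Pn[u uv]] := eqVneq (nbr v) set0.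
    by rewrite /= !nbr0_kind // -fim v0 imset0.
  have [_ /= e] := fP u uv; have fuw : f u \in nbr w by rewrite -fim imset_f.
  by apply: negb_inj; rewrite -(nbr_kind uv) -(nbr_kind fuw).
exists f; split=> // u uv; have [lab d] := fP u uv; split=> //; exact: IH.
Qed.

Lemma same_delta_le S S' i j (v : fvert S) (w : fvert S') :
  i <= j -> same_delta j v w -> same_delta i v w.
Proof.
move=> /subnK <-; elim: (j - i) => // n IH; rewrite addSn => /same_delta_pred; exact: IH.
Qed.

(* There are finitely many maps, so one of them serves all rounds. *)
Lemma stab_step S S' (v : fvert S) (w : fvert S') : stab v w ->
  exists f : fvert S -> fvert S',
    [/\ {in nbr v &, injective f}, f @: nbr v = nbr w &
      forall u, u \in nbr v -> flabel v u = flabel w (f u) /\ stab u (f u)].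
Proof.
move=> vw.
pose Q j (f : fvert S -> fvert S') := [/\ {in nbr v &, injective f}, f @: nbr v = nbr w &
  forall u, u \in nbr v -> flabel v u = flabel w (f u) /\ same_delta j u (f u)].
case: (pselect (exists f : {ffun fvert S -> fvert S'}, forall j, Q j f)) => [[f fQ]|none].
  exists f; have [finj fim _] := fQ 0; split=> // u uv; split=> [|j].
    by have [_ _ /(_ u uv)[]] := fQ 0.
  by have [_ _ /(_ u uv)[]] := fQ j.
have bad (f : {ffun fvert S -> fvert S'}) : exists j, ~ Q j f.
  by apply/existsNP => fQ; apply: none; exists f.
have [b bP] := fin_all_exists bad.
pose n := \max_f b f.
have [f [finj fim fP]] := vw n.+1.
case: (bP [ffun u => f u]); have bn : b [ffun u => f u] <= n by apply: leq_bigmax.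
split=> [u u' uv uv'||u uv]; rewrite ?ffunE.
- exact: finj.
- by rewrite -fim; apply: eq_imset => u; rewrite ffunE.
- by have [lab d] := fP u uv; split=> //; apply: same_delta_le bn d.
Qed.

Lemma stab_constr S S' s (t : {ffun 'I_(ar s) -> univ S}) (u : {ffun 'I_(ar s) -> univ S'})
    (ts : t \in rels S s) (us : u \in rels S' s) :
  stab (inr (cvert ts)) (inr (cvert us)) -> forall m, stab (inl (t m)) (inl (u m)).
Proof.
move=> /stab_step[f [_ fim fP]] m.
have tm : inl (t m) \in nbr (inr (cvert ts)) by apply/nbr_constr; exists m.
have [+ st] := fP _ tm; have : f (inl (t m)) \in nbr (inr (cvert us)) by rewrite -fim imset_f.
case/nbr_constr=> m' e; move: st; rewrite e => st /Some_inj lab.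
have [u' [us' [eu lab']]] := elabel_inv (d := cvert us) lab.
have {}eu : u = u' by apply: mkc_inj; apply: (congr1 val eu).
by have := lab' m; rewrite eqxx -eu => /esym/eqP ->.
Qed.

Lemma stab_nbr S S' (x : univ S) (y : univ S') : stab (inl x) (inl y) ->
  exists f : fvert S -> fvert S',
    {in nbr (inl x) &, injective f} /\
    forall s (m : 'I_(ar s)) (t : {ffun 'I_(ar s) -> univ S}) (ts : t \in rels S s),
      t m = x -> exists u (us : u \in rels S' s),
        [/\ f (inr (cvert ts)) = inr (cvert us), u m = y &
          forall m', stab (inl (t m')) (inl (u m'))].
Proof.
move=> /stab_step[f [finj fim fP]]; exists f; split=> // s m t ts tm.
have cx : inr (cvert ts) \in nbr (inl x) by apply/nbr_elt; exists s, t, ts, m.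
have [+ st] := fP _ cx; have : f (inr (cvert ts)) \in nbr (inl y) by rewrite -fim imset_f.
rewrite inE; case fc: (f _) => [|d] // _ /Some_inj lab.
have [u [us [ed lab']]] := elabel_inv lab; exists u, us; split; first by rewrite ed.
  by have := lab' m; rewrite tm eqxx => /esym/eqP.
by apply: stab_constr (ts) (us) _; rewrite -ed -fc.
Qed.

Lemma stab_walk S S' (x : univ S) (y : univ S') s (m : 'I_(ar s))
    (t : {ffun 'I_(ar s) -> univ S}) :
  stab (inl x) (inl y) -> t \in rels S s -> t m = x ->
  exists u, [/\ u \in rels S' s, u m = y & forall m', stab (inl (t m')) (inl (u m'))].
Proof.
move=> /stab_nbr[f [_ fP]] ts tm; have [u [us [_ um ut]]] := fP s m t ts tm.
by exists u.
Qed.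

Lemma equiv1_inj S S' : equiv1 S S' ->
  exists f : univ S -> univ S', injective f /\ forall x, stab (inl x) (inl (f x)).
Proof.
move=> [g [gbij gP]].
have ex x : exists y, g (inl x) = inl y.
  by have := gP 0 (inl x); case: (g _) => // y _; exists y.
have [f fP] := fin_all_exists ex; exists f; split=> [x x' e|x j].
  have : g (inl x) = g (inl x') by rewrite !fP e.
  by move/(bij_inj gbij) => [].
by rewrite -fP.
Qed.
End Refinement.

(** * From systems to colour refinement of the tuple structure *)

(** Specifying a map by a relation keeps membership proofs of constraints out of the definition of
    the function. *)
Lemma inj_of_rel (X Y : finType) (D : {pred X}) (r : X -> Y -> Prop) (f0 : X -> Y) :
  (forall x, x \in D -> exists y, r x y) ->
  (forall x x' y, x \in D -> x' \in D -> r x y -> r x' y -> x = x') ->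
  exists f : X -> Y, {in D &, injective f} /\ forall x, x \in D -> r x (f x).
Proof.
move=> ex un.
have ex' x : exists y, x \in D -> r x y.
  by case: (boolP (x \in D)) => [/ex[y]|_]; [exists y|exists (f0 x)].
have [f fP] := fin_all_exists ex'; exists f; split=> // x x' xD x'D e.
by apply: (un x x' (f x)) => //; [apply: fP|rewrite e; apply: fP].
Qed.

Definition pr2 (T : finType) (x x' : T) : {ffun 'I_2 -> T} :=
  [ffun m => if m == ord0 then x else x'].

Lemma ord2P (m : 'I_2) : m = ord0 \/ m = o1.
Proof. by case: m => [[|[|m]] // lt]; [left|right]; apply: val_inj. Qed.

Lemma pr2_0 (T : finType) (x x' : T) : pr2 x x' ord0 = x.
Proof. by rewrite ffunE. Qed.

Lemma pr2_1 (T : finType) (x x' : T) : pr2 x x' o1 = x'.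
Proof. by rewrite ffunE. Qed.

Definition reidx n n' (T : finType) (i : 'I_n' -> 'I_n) (a : {ffun 'I_n -> T}) :
  {ffun 'I_n' -> T} := [ffun m => a (i m)].

Lemma gr_reidx n n' (A B : finType) (i : 'I_n' -> 'I_n) (a : {ffun 'I_n -> A})
    (b : {ffun 'I_n -> B}) :
  gr setT (reidx i a) (reidx i b) \subset gr setT a b.
Proof.
apply/subsetP => _ /imsetP[m _ ->]; rewrite !ffunE; exact: mem_gr.
Qed.

Lemma mktup_inj (T : finType) k (j : 'I_k) : injective (@mktup T k j).
Proof. by move=> t t' /eqP; rewrite eq_Tagged => /eqP. Qed.

(** * Transporting tuples with a prescribed projection *)

Section TupleExtension.
Variables (sg : signature) (k : nat) (A B : structure sg).
Variable P : {set univ A * univ B} -> Prop.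
Hypotheses (k0 : 0 < k) (bf : bf_system k P).

Lemma bf_inj n (i : 'I_n -> univ A) (i' : 'I_n -> univ B) :
  P (gr setT i i') -> forall m m', (i m == i m') = (i' m == i' m').
Proof.
move=> /(bf_iso bf)[w1 w2 _] m m'; apply/eqP/eqP => e.
  by apply: (w1 (i m)); [apply: mem_gr|rewrite e; apply: mem_gr].
by apply: (w2 _ _ (i' m)); [apply: mem_gr|rewrite e; apply: mem_gr].
Qed.

Lemma bf_rel R (t : {ffun 'I_(ar R) -> univ A}) (u : {ffun 'I_(ar R) -> univ B}) :
  P (gr setT t u) -> (t \in rels A R) = (u \in rels B R).
Proof. by move=> /(bf_iso bf)[_ _]; apply=> i; apply: mem_gr. Qed.

(** An instance of [elim_transfer] on the index set: the base clique is the image of [i], where the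
    values are prescribed, and since [n <= k] one further clique may contain all indices. *)
Lemma tuple_ext n n' (i : 'I_n' -> 'I_n) (a : {ffun 'I_n' -> univ A})
    (b : {ffun 'I_n' -> univ B}) :
  n <= k -> P (gr setT a b) ->
  exists F : {ffun 'I_n -> univ A} -> {ffun 'I_n -> univ B},
    {in [pred a' | reidx i a' == a] &, injective F} /\
    forall a', reidx i a' = a -> reidx i (F a') = b /\ P (gr setT a' (F a')).
Proof.
move=> nk Pab.
have [f0 _] := bf_forth bf (bf_empty bf) (eq_ind_r (fun n => n < k) k0 (cards0 _)).
have [[a0 a0i]|none] := pselect (exists a0 : {ffun 'I_n -> univ A}, reidx i a0 = a); last first.
  exists (fun a' => [ffun m => f0 (a' m)]); split=> [a1 a2|a1 e]; last by case: none; exists a1.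
  by rewrite inE => /eqP e; case: none; exists a1.
(* On the image of [i] the values are forced by [b], consistently because [a] and [b] have the same
   equality pattern; elsewhere [f0] is a filler. *)
pose b0 : {ffun 'I_n -> univ B} :=
  [ffun m => if [pick x | i x == m] is Some x then b x else f0 (a0 m)].
have b0i x : b0 (i x) = b x.
  rewrite ffunE; case: pickP => [x' /eqP ix'|/(_ x)]; last by rewrite eqxx.
  by apply/eqP; rewrite -(bf_inj Pab) -a0i !ffunE ix'.
pose M := [set i x | x : 'I_n'].
have P0 : P (gr M a0 b0).
  apply: bf_subset bf _ _ _ Pab; apply/subsetP => _ /imsetP[_ /imsetP[x _ ->] ->].
  by rewrite b0i -[a0 (i x)](ffunE (fun x => a0 (i x))) -/(reidx i a0) a0i; apply: mem_gr.
have [||||L [eL _ _ [C CL fullC]]] := @elim_add _ k M [:: M] M setT.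
- exact: elim_base.
- by rewrite inE.
- by rewrite /cov big_seq1 subsetIr.
- by rewrite cardsT card_ord.
have CT : C = setT by apply/eqP; rewrite -subTset.
rewrite {}CT {fullC} in CL.
have covL : cov L = setT.
  by apply/eqP; rewrite -subTset; apply/subsetP => x; apply: mem_cov CL.
have [F [F1 F2]] := elim_transfer k0 bf P0 eL.
have agree a' : reidx i a' = a -> {in M, a' =1 a0}.
  by rewrite -a0i => /ffunP e _ /imsetP[x _ ->]; have := e x; rewrite !ffunE.
exists F; split=> [a1 a2|a1 e].
  rewrite !inE => /eqP/agree h1 /eqP/agree h2 e; apply/ffunP => x.
  by apply: (F2 _ _ h1 h2); rewrite ?covL ?e.
have [Fb Fp] := F1 a1 (agree _ e); split; last exact: Fp.
by apply/ffunP => x; rewrite ffunE Fb ?b0i // imset_f.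
Qed.

Lemma tuple_inj n : n <= k ->
  exists F : {ffun 'I_n -> univ A} -> {ffun 'I_n -> univ B},
    injective F /\ forall a : {ffun 'I_n -> univ A}, P (gr setT a (F a)).
Proof.
move=> nk; pose i (x : 'I_0) : 'I_n := widen_ord (leq0n n) x.
pose a : {ffun 'I_0 -> univ A} := ffun0 (card_ord 0).
pose b : {ffun 'I_0 -> univ B} := ffun0 (card_ord 0).
have triv a' : reidx i a' = a by apply/ffunP => -[].
have [|F [F1 F2]] := @tuple_ext n 0 i a b nk.
  apply: bf_subset bf _ _ _ (bf_empty bf); apply/subsetP => _ /imsetP[[] //].
exists F; split=> [a1 a2 e|a1]; last by have [] := F2 a1 (triv a1).
by apply: F1 e; rewrite inE triv.
Qed.
End TupleExtension.

Section StarRelations.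
Variables (sg : signature) (k : nat).

Definition symT (j : 'I_k) (SS : {set 'I_j.+1}) : starsym sg k :=
  inl (inl (existT (fun j : 'I_k => {set 'I_j.+1}) j SS)).
Definition symR (R : sym sg) (SS : {set 'I_(ar R)}) : starsym sg k :=
  inl (inr (existT (fun R : sym sg => {set 'I_(ar R)}) R SS)).
Definition projT (j j' : 'I_k) (i : {ffun 'I_j'.+1 -> 'I_j.+1}) : starsym sg k :=
  inr (inl (existT (fun jj : 'I_k * 'I_k => {ffun 'I_jj.2.+1 -> 'I_jj.1.+1}) (j, j') i)).
Definition projR (R : sym sg) (j : 'I_k) (i : {ffun 'I_j.+1 -> 'I_(ar R)}) : starsym sg k :=
  inr (inr (existT (fun p : sym sg * 'I_k => {ffun 'I_p.2.+1 -> 'I_(ar p.1)}) (R, j) i)).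

Arguments symT {j} SS.
Arguments symR {R} SS.
Arguments projT {j j'} i.
Arguments projR {R j} i.

Lemma starsymP (s : starsym sg k) :
  [\/ exists j SS, s = symT (j := j) SS, exists R SS, s = symR (R := R) SS,
      exists j j' i, s = projT (j := j) (j' := j') i |
      exists R j i, s = projR (R := R) (j := j) i].
Proof.
case: s => [[[j SS]|[R SS]]|[[[j j'] i]|[[R j] i]]].
- by apply: Or41; exists j, SS.
- by apply: Or42; exists R, SS.
- by apply: Or43; exists j, j', i.
- by apply: Or44; exists R, j, i.
Qed.

Variable A : structure sg.
Local Notation tup a := (inl (mktup a) : starU A k).
Local Notation con aR := (inr (cvert aR) : starU A k).

Lemma is_constrP (x : starU A k) R (a : {ffun 'I_(ar R) -> univ A}) :
  reflect (exists aR : a \in rels A R, x = con aR) ((a \in rels A R) && is_constr x a).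
Proof.
apply: (iffP andP) => [[aR]|[aR ->]]; last by rewrite /= eqxx.
by case: x => //= c /eqP e; exists aR; congr inr; apply: val_inj.
Qed.

Lemma in_symT (j : 'I_k) (SS : {set 'I_j.+1}) (t : {ffun 'I_1 -> starU A k}) :
  t \in starrel A (symT (j := j) SS) <->
  exists a, t ord0 = tup a /\ {in SS &, forall i i', a i = a i'}.
Proof.
rewrite inE; split=> [/existsP[a /andP[/eqP ta /forall_inP H]]|[a [ta H]]].
  by exists a; split=> // i i' iS i'S; have /forall_inP/(_ i' i'S)/eqP := H i iS.
apply/existsP; exists a; rewrite ta eqxx; apply/forall_inP => i iS.
by apply/forall_inP => i' i'S; rewrite (H i i').
Qed.

Lemma in_symR R (SS : {set 'I_(ar R)}) (t : {ffun 'I_1 -> starU A k}) :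
  t \in starrel A (symR (R := R) SS) <->
  exists a (aR : a \in rels A R), t ord0 = con aR /\ {in SS &, forall i i', a i = a i'}.
Proof.
rewrite inE; split=> [/existsP[a /and3P[aR ac /forall_inP H]]|[a [aR [ta H]]]].
  have /is_constrP[aR' ta] : (a \in rels A R) && is_constr (t ord0) a by rewrite aR.
  by exists a, aR'; split=> // i i' iS i'S; have /forall_inP/(_ i' i'S)/eqP := H i iS.
apply/existsP; exists a; rewrite andbA; apply/andP; split.
  by apply/is_constrP; exists aR.
apply/forall_inP => i iS.
by apply/forall_inP => i' i'S; rewrite (H i i').
Qed.

Lemma in_projT (j j' : 'I_k) (i : {ffun 'I_j'.+1 -> 'I_j.+1}) (t : {ffun 'I_2 -> starU A k}) :
  t \in starrel A (projT (j := j) (j' := j') i) <->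
  exists a, t ord0 = tup a /\ t o1 = tup (reidx i a).
Proof.
rewrite inE; split=> [/existsP[a /andP[/eqP ta /eqP tb]]|[a [ta tb]]].
  by exists a.
by apply/existsP; exists a; rewrite ta tb !eqxx.
Qed.

Lemma in_projR R (j : 'I_k) (i : {ffun 'I_j.+1 -> 'I_(ar R)}) (t : {ffun 'I_2 -> starU A k}) :
  t \in starrel A (projR (R := R) (j := j) i) <->
  exists a (aR : a \in rels A R), t ord0 = con aR /\ t o1 = tup (reidx i a).
Proof.
rewrite inE; split=> [/existsP[a /and3P[aR ac /eqP tb]]|[a [aR [ta tb]]]].
  have /is_constrP[aR' ta] : (a \in rels A R) && is_constr (t ord0) a by rewrite aR.
  by exists a, aR'.
apply/existsP; exists a; rewrite tb eqxx andbT.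
by apply/is_constrP; exists aR.
Qed.

Lemma tup_inj (j : 'I_k) : injective (fun a : {ffun 'I_j.+1 -> univ A} => tup a).
Proof.
by move=> a a' e; apply: mktup_inj; apply: inl_inj e.
Qed.

Lemma con_inj R (a a' : {ffun 'I_(ar R) -> univ A}) (aR : a \in rels A R)
  (aR' : a' \in rels A R) : con aR = con aR' -> a = a'.
Proof.
by move=> e; apply: mkc_inj; apply: (congr1 val (inr_inj e)).
Qed.
End StarRelations.
Arguments symT {sg k j} SS.
Arguments symR {sg k R} SS.
Arguments projT {sg k j j'} i.
Arguments projR {sg k R j} i.

Section StarSim.
Variables (sg : signature) (k : nat) (A B : structure sg).
Variable P : {set univ A * univ B} -> Prop.

Inductive star_sim : starU A k -> starU B k -> Prop :=
| SimTup (j : 'I_k) (a : {ffun 'I_j.+1 -> univ A}) (b : {ffun 'I_j.+1 -> univ B}) :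
    P (gr setT a b) -> star_sim (inl (mktup a)) (inl (mktup b))
| SimCon R (a : {ffun 'I_(ar R) -> univ A}) (b : {ffun 'I_(ar R) -> univ B})
    (aR : a \in rels A R) (bR : b \in rels B R) :
    P (gr setT a b) -> star_sim (inr (cvert aR)) (inr (cvert bR)).

Lemma star_sim_inv x y : star_sim x y ->
  match x with
  | inl ta => exists (j : 'I_k) (a : {ffun 'I_j.+1 -> univ A}) b,
      [/\ ta = mktup a, y = inl (mktup b) & P (gr setT a b)]
  | inr c => exists R (a : {ffun 'I_(ar R) -> univ A}) b (aR : a \in rels A R)
      (bR : b \in rels B R), [/\ c = cvert aR, y = inr (cvert bR) & P (gr setT a b)]
  end.
Proof. by case=> [j a b|R a b aR bR] Pab; [exists j, a, b|exists R, a, b, aR, bR]. Qed.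

Lemma star_sim_tup (j : 'I_k) (a : {ffun 'I_j.+1 -> univ A}) y :
  star_sim (inl (mktup a)) y -> exists b, y = inl (mktup b) /\ P (gr setT a b).
Proof.
case/star_sim_inv=> j' [a' [b' [e -> Pab]]].
have ej : j = j' := congr1 tag e; subst j'; have ea := mktup_inj e; subst a'.
by exists b'.
Qed.

Lemma star_sim_con R (a : {ffun 'I_(ar R) -> univ A}) (aR : a \in rels A R) y :
  star_sim (inr (cvert aR)) y ->
  exists b (bR : b \in rels B R), y = inr (cvert bR) /\ P (gr setT a b).
Proof.
case/star_sim_inv=> R' [a' [b' [aR' [bR' [/(congr1 val) e -> Pab]]]]].
have eR : R = R' := congr1 tag e; subst R'; have ea := mkc_inj e; subst a'.
by exists b', bR'.
Qed.

Hypotheses (k0 : 0 < k) (ark : maxar sg <= k) (bf : bf_system k P).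

Let ar_le (R : sym sg) : ar R <= k.
Proof. exact: leq_trans (leq_bigmax R) ark. Qed.

Lemma star_sim_inj : exists f : starU A k -> starU B k,
  injective f /\ forall x, star_sim x (f x).
Proof.
have [F FP] := fin_all_exists (fun j : 'I_k => tuple_inj k0 bf (ltn_ord j)).
have [G GP] := fin_all_exists (fun R : sym sg => tuple_inj k0 bf (ar_le R)).
have GR R (a : {ffun 'I_(ar R) -> univ A}) : a \in rels A R -> G R a \in rels B R.
  by have [_ /(_ a)/(bf_rel bf) <-] := GP R.
pose f (x : starU A k) : starU B k :=
  match x with
  | inl (existT j a) => inl (mktup (F j a))
  | inr c => inr (cvert (GR (tag (val c)) (tagged (val c)) (valP c)))
  end.
have fE R (a : {ffun 'I_(ar R) -> univ A}) (aR : a \in rels A R) :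
  f (inr (cvert aR)) = inr (cvert (GR R a aR)) by congr inr; apply: val_inj.
exists f; split=> [[[j a]|c] [[j' a']|c'] //|[[j a]|c]].
- move=> e; have {}e := inl_inj e.
  have ej : j = j' := congr1 tag e; subst j'.
  by have [Finj _] := FP j; rewrite (Finj _ _ (mktup_inj e)).
- have [R [a [aR ->]]] := cvertP c; have [R' [a' [aR' ->]]] := cvertP c'; rewrite !fE.
  move=> e; have {}e := congr1 val (inr_inj e).
  have eR : R = R' := congr1 tag e; subst R'.
  have [Ginj _] := GP R; have ea := Ginj _ _ (mkc_inj e); subst a'.
  by congr inr; apply: val_inj.
- by apply: SimTup; have [_] := FP j.
- have [R [a [aR ->]]] := cvertP c; rewrite fE.
  by apply: SimCon; have [_] := GP R.
Qed.

(** Whether a tuple equals its own projection depends only on its equality pattern; this settles the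
    case of a projection constraint whose two entries coincide. *)
Lemma mktup_reidx_eq (U V : finType) (j j' : 'I_k) (i : {ffun 'I_j'.+1 -> 'I_j.+1})
    (a : {ffun 'I_j.+1 -> U}) (b : {ffun 'I_j.+1 -> V}) :
  (forall m m', a m = a m' -> b m = b m') ->
  mktup a = mktup (reidx i a) -> mktup b = mktup (reidx i b).
Proof.
move=> ab e; have ej : j = j' := congr1 tag e; subst j'.
have /ffunP ea := mktup_inj e; congr mktup; apply/ffunP => m.
by have := ea m; rewrite !ffunE; apply: ab.
Qed.

Lemma star_sim_eq (s : starsym sg k) (t : {ffun 'I_(starar s) -> starU A k})
    (u : {ffun 'I_(starar s) -> starU B k}) :
  t \in starrel A s -> u \in starrel B s -> (forall m, star_sim (t m) (u m)) ->
  forall m m', (t m == t m') = (u m == u m').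
Proof.
case: (starsymP s) => [[j [SS es]]|[R [SS es]]|[j [j' [i es]]]|[R [j [i es]]]]; subst s.
- by move=> _ _ _ m m'; rewrite (ord1 m) (ord1 m') !eqxx.
- by move=> _ _ _ m m'; rewrite (ord1 m) (ord1 m') !eqxx.
- move=> /in_projT[a [t0 t1]] /in_projT[b [u0 u1]] tu.
  have := tu ord0; rewrite t0 u0 => /star_sim_tup[b' [/tup_inj eb Pab]]; subst b'.
  have ab := bf_inj bf Pab.
  have e01 : (t ord0 == t o1) = (u ord0 == u o1).
    rewrite t0 t1 u0 u1; apply/eqP/eqP => e; congr inl; have {}e := inl_inj e.
      by apply: mktup_reidx_eq e => m m' /eqP; rewrite ab => /eqP.
    by apply: mktup_reidx_eq e => m m' /eqP; rewrite -ab => /eqP.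
  by move=> m m'; case: (ord2P m) => ->; case: (ord2P m') => ->; rewrite ?eqxx // eq_sym e01 eq_sym.
- move=> /in_projR[a [aR [t0 t1]]] /in_projR[b [bR [u0 u1]]] _ m m'.
  by case: (ord2P m) => ->; case: (ord2P m') => ->; rewrite ?eqxx // ?t0 ?t1 ?u0 ?u1.
Qed.

(** For a unary symbol, or at the first entry of a projection, the tuple is determined by [x] and
    injectivity is immediate. At the second entry the tuples are the extensions of [x] along [i],
    transported by [tuple_ext]; the arity bound makes this apply to constraints as well. *)
Lemma star_sim_nbr (x : starU A k) (y : starU B k) :
  star_sim x y -> forall (s : starsym sg k) (m : 'I_(starar s)),
    exists f : {ffun 'I_(starar s) -> starU A k} -> {ffun 'I_(starar s) -> starU B k},
      {in [pred t in starrel A s | t m == x] &, injective f} /\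
      forall t, t \in starrel A s -> t m = x ->
        [/\ f t \in starrel B s, f t m = y & forall m', star_sim (t m') (f t m')].
Proof.
move=> xy s m.
suff [r [r_ok r_ex r_un]] : exists r : {ffun 'I_(starar s) -> starU A k} ->
    {ffun 'I_(starar s) -> starU B k} -> Prop,
  [/\ forall t u, r t u -> [/\ u \in starrel B s, u m = y & forall m', star_sim (t m') (u m')],
     forall t, t \in starrel A s -> t m = x -> exists u, r t u &
     forall t t' u, t \in starrel A s -> t m = x -> t' \in starrel A s -> t' m = x ->
       r t u -> r t' u -> t = t'].
  have [||f [f1 f2]] := @inj_of_rel _ _ [pred t in starrel A s | t m == x] r (fun=> [ffun=> y]).
  - by move=> t /andP[ts /eqP tm]; apply: r_ex.
  - by move=> t t' u /andP[ts /eqP tm] /andP[ts' /eqP tm']; apply: r_un.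
  exists f; split=> // t ts tm; apply: r_ok; apply: f2.
  by rewrite inE ts tm eqxx.
case: (starsymP s) => [[j [SS es]]|[R [SS es]]|[j [j' [i es]]]|[R [j [i es]]]]; subst s.
- exists (fun t u => [/\ u \in starrel B (symT SS), u m = y & forall m', star_sim (t m') (u m')]).
  split=> // [t /in_symT[a [t0 H]] tm|t t' u _ tm _ tm' _ _]; last first.
    by apply/ffunP => m'; rewrite (ord1 m') -(ord1 m) tm tm'.
  rewrite (ord1 m) t0 in tm; subst x.
  have [b [eb Pab]] := star_sim_tup xy; exists [ffun=> y]; split=> [||m']; rewrite ?ffunE //.
    apply/in_symT; exists b; rewrite ffunE eb; split=> // i i' iS i'S.
    by apply/eqP; rewrite -(bf_inj bf Pab); apply/eqP; apply: H.
  by rewrite (ord1 m') t0.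
- exists (fun t u => [/\ u \in starrel B (symR SS), u m = y & forall m', star_sim (t m') (u m')]).
  split=> // [t /in_symR[a [aR [t0 H]]] tm|t t' u _ tm _ tm' _ _]; last first.
    by apply/ffunP => m'; rewrite (ord1 m') -(ord1 m) tm tm'.
  rewrite (ord1 m) t0 in tm; subst x.
  have [b [bR [eb Pab]]] := star_sim_con xy; exists [ffun=> y]; split=> [||m']; rewrite ?ffunE //.
    apply/in_symR; exists b, bR; rewrite ffunE eb; split=> // i i' iS i'S.
    by apply/eqP; rewrite -(bf_inj bf Pab); apply/eqP; apply: H.
  by rewrite (ord1 m') t0.
- case: (ord2P m) => em; subst m.
    exists (fun t u => [/\ u \in starrel B (projT i), u ord0 = y & forall m', star_sim (t m') (u m')]).
    split=> // [t /in_projT[a [t0 t1]] tm|t t' u /in_projT[a [t0 t1]] tm /in_projT[a' [t0' t1']] tm' _ _].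
      rewrite t0 in tm; subst x; have [b [eb Pab]] := star_sim_tup xy; subst y.
      exists (pr2 (inl (mktup b)) (inl (mktup (reidx i b)))); split=> [||m'].
      + by apply/in_projT; exists b; rewrite pr2_0 pr2_1.
      + by rewrite pr2_0.
      + case: (ord2P m') => ->; rewrite ?pr2_0 ?pr2_1 ?t0 ?t1; apply: SimTup => //.
        exact: bf_subset bf _ _ (gr_reidx _ _ _) Pab.
    have ea : a = a' by apply: (@tup_inj _ k A j); rewrite /= -t0 -t0' tm tm'.
    by apply/ffunP => m'; case: (ord2P m') => ->; rewrite ?tm ?tm' // t1 t1' ea.
  case: (pselect (exists a1 : {ffun 'I_j'.+1 -> univ A}, x = inl (mktup a1))) => [[a1 ex]|none]; last first.
    exists (fun _ _ => False); split=> // t /in_projT[a [t0 t1]] tm.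
    by case: none; exists (reidx i a); rewrite -tm.
  subst x; have [b1 [eb Pab]] := star_sim_tup xy; subst y.
  have [F [F1 F2]] := tuple_ext k0 bf i (ltn_ord j) Pab.
  exists (fun t u => exists a, [/\ t = pr2 (inl (mktup a)) (inl (mktup a1)), reidx i a = a1 &
    u = pr2 (inl (mktup (F a))) (inl (mktup b1))]).
  split=> [t u [a [-> ea ->]]|t /in_projT[a [t0 t1]] tm|t t' u _ _ _ _ [a [-> ea ->]] [a' [-> ea' e]]].
  + have [eFa PFa] := F2 a ea; split=> [||m'].
    * by apply/in_projT; exists (F a); rewrite pr2_0 pr2_1 eFa.
    * by rewrite pr2_1.
    * by case: (ord2P m') => ->; rewrite ?pr2_0 ?pr2_1; apply: SimTup.
  + have ea : reidx i a = a1 by apply: (@tup_inj _ k A j'); rewrite /= -t1.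
    exists (pr2 (inl (mktup (F a))) (inl (mktup b1))), a; split=> //.
    by apply/ffunP => m'; case: (ord2P m') => ->; rewrite ?pr2_0 ?pr2_1.
  + congr (pr2 (inl (mktup _)) _); apply: F1; rewrite ?inE ?ea ?ea' //.
    by apply: (@tup_inj _ k B j); move/ffunP/(_ ord0): e; rewrite !pr2_0.
- case: (ord2P m) => em; subst m.
    exists (fun t u => [/\ u \in starrel B (projR i), u ord0 = y & forall m', star_sim (t m') (u m')]).
    split=> // [t /in_projR[a [aR [t0 t1]]] tm|t t' u /in_projR[a [aR [t0 t1]]] tm /in_projR[a' [aR' [t0' t1']]] tm' _ _].
      rewrite t0 in tm; subst x; have [b [bR [eb Pab]]] := star_sim_con xy; subst y.
      exists (pr2 (inr (cvert bR)) (inl (mktup (reidx i b)))); split=> [||m'].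
      + by apply/in_projR; exists b, bR; rewrite pr2_0 pr2_1.
      + by rewrite pr2_0.
      + case: (ord2P m') => ->; rewrite ?pr2_0 ?pr2_1 ?t0 ?t1; first exact: SimCon.
        by apply: SimTup; apply: bf_subset bf _ _ (gr_reidx _ _ _) Pab.
    have ea : a = a' by apply: (@con_inj _ k A _ _ _ aR aR'); rewrite -t0 -t0' tm tm'.
    by apply/ffunP => m'; case: (ord2P m') => ->; rewrite ?tm ?tm' // t1 t1' ea.
  case: (pselect (exists a1 : {ffun 'I_j.+1 -> univ A}, x = inl (mktup a1))) => [[a1 ex]|none]; last first.
    exists (fun _ _ => False); split=> // t /in_projR[a [aR [t0 t1]]] tm.
    by case: none; exists (reidx i a); rewrite -tm.
  subst x; have [b1 [eb Pab]] := star_sim_tup xy; subst y.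
  have [F [F1 F2]] := tuple_ext k0 bf i (ar_le R) Pab.
  exists (fun t u => exists a (aR : a \in rels A R) (bR : F a \in rels B R),
    [/\ t = pr2 (inr (cvert aR)) (inl (mktup a1)), reidx i a = a1 &
    u = pr2 (inr (cvert bR)) (inl (mktup b1))]).
  split=> [t u [a [aR [bR [-> ea ->]]]]|t /in_projR[a [aR [t0 t1]]] tm|t t' u _ _ _ _ [a [aR [bR [-> ea ->]]]] [a' [aR' [bR' [-> ea' e]]]]].
  + have [eFa PFa] := F2 a ea; split=> [||m'].
    * by apply/in_projR; exists (F a), bR; rewrite pr2_0 pr2_1 eFa.
    * by rewrite pr2_1.
    * by case: (ord2P m') => ->; rewrite ?pr2_0 ?pr2_1; [apply: SimCon|apply: SimTup].
  + have ea : reidx i a = a1 by apply: (@tup_inj _ k A j); rewrite /= -t1.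
    have [_ /(bf_rel bf)] := F2 a ea; rewrite aR => /esym bR.
    exists (pr2 (inr (cvert bR)) (inl (mktup b1))), a, aR, bR; split=> //.
    by apply/ffunP => m'; case: (ord2P m') => ->; rewrite ?pr2_0 ?pr2_1.
  + have eaa : a = a'.
      apply: F1; rewrite ?inE ?ea ?ea' //.
      by apply: (@con_inj _ k B _ _ _ bR bR'); move/ffunP/(_ ord0): e; rewrite !pr2_0.
    by subst a'; congr (pr2 (inr _) _); apply: val_inj.
Qed.

Lemma star_half_sim : half_sim (S := star A k) (S' := star B k) star_sim.
Proof.
split; [exact: star_sim_inj|exact: star_sim_nbr|exact: star_sim_eq].
Qed.
End StarSim.

Lemma star_sim_swap sg k (A B : structure sg) (P : {set univ A * univ B} -> Prop)
    (x : starU A k) (y : starU B k) :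
  star_sim (P \o @swap _ _) y x <-> star_sim P x y.
Proof.
have E n (a : {ffun 'I_n -> univ A}) (b : {ffun 'I_n -> univ B}) :
    swap (gr setT b a) = gr setT a b by rewrite /swap /gr -imset_comp.
by split=> -[j a b|R a b aR bR] Pab; [apply: SimTup|apply: SimCon|apply: SimTup|apply: SimCon];
  rewrite ?E //= ?E // -E in Pab *.
Qed.

Lemma bf_star_equiv1 sg k (A B : structure sg) (P : {set univ A * univ B} -> Prop) :
  0 < k -> maxar sg <= k -> bf_system k P -> equiv1 (star A k) (star B k).
Proof.
move=> k0 ark bf; apply: half_sim_equiv1 (star_half_sim k0 ark bf) _.
have -> : (fun (y : starU B k) (x : starU A k) => star_sim P x y) = star_sim (P \o @swap _ _).
  by apply/funext => y; apply/funext => x; apply/propext; rewrite star_sim_swap.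
exact: star_half_sim (bf_sym bf).
Qed.

(** * From colour refinement to systems *)

Lemma maxar1_ord (sg : signature) (R : sym sg) (m m' : 'I_(ar R)) :
  maxar sg <= 1 -> m = m'.
Proof.
move=> ar1; have : ar R <= 1 := leq_trans (leq_bigmax R) ar1.
move=> aR; apply: val_inj.
have := leq_trans (ltn_ord m) aR; have := leq_trans (ltn_ord m') aR.
by rewrite !ltnS !leqn0 => /eqP m'0 /eqP m0; rewrite [LHS]m0 [RHS]m'0.
Qed.

(** * The case k = 1 *)

Section ArityOne.
Variables (sg : signature) (A B : structure sg).
Hypothesis ar1 : maxar sg <= 1.

Lemma bf_half_sim1 (P : {set univ A * univ B} -> Prop) :
  bf_system 1 P -> half_sim (fun a b => P [set (a, b)]).
Proof.
move=> bf; split=> [|x y Pxy s m|s t u _ _ _ m m'].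
- have [|f [fbij fP]] := bf_forth bf (bf_empty bf); first by rewrite cards0.
  exists f; split=> [|x]; first exact: bij_inj.
  by have := fP x; rewrite setU0.
- exists (fun=> [ffun=> y]); split=> [t t'|t ts tm].
    rewrite !inE => /andP[_ /eqP tm] /andP[_ /eqP tm'] _.
    by apply/ffunP => m'; rewrite (maxar1_ord m' m ar1) tm.
  split=> [||m']; rewrite ?ffunE //; last by rewrite (maxar1_ord m' m ar1) tm.
  have [_ _ isoR] := bf_iso bf Pxy; rewrite -(isoR s t) // => m'.
  by rewrite ffunE (maxar1_ord m' m ar1) tm inE.
- by rewrite (maxar1_ord m m' ar1) !eqxx.
Qed.

Lemma injections_bij (f : univ A -> univ B) (g : univ B -> univ A) :
  injective f -> injective g -> bijective f.
Proof. by move=> fi gi; apply: inj_card_bij fi _; apply: leq_card gi. Qed.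

Lemma equiv1_bf1 : equiv1 A B -> exists P, bf_system 1 (A := A) (B := B) P.
Proof.
move=> AB; have [f [finj fP]] := equiv1_inj AB.
have [g [ginj _]] := equiv1_inj (equiv1_sym AB).
exists (fun p : {set univ A * univ B} =>
  p = set0 \/ exists a b, p \subset [set (a, b)] /\ stab (inl a) (inl b)); split.
- by left.
- move=> p q qp [p0|[a [b [pab st]]]].
    by left; apply/eqP; rewrite -subset0 -p0.
  by right; exists a, b; split=> //; apply: subset_trans pab.
- move=> p [->|[a [b [/subsetP pab st]]]].
    split=> [a b b'|a a' b|R t u tu]; rewrite ?inE //.
    by have := tu (Ordinal (ar_pos R)); rewrite inE.
  have sub x y : (x, y) \in p -> x = a /\ y = b.
    by move=> /pab; rewrite inE => /eqP[-> ->].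
  split=> [x y y' /sub[_ ->] /sub[_ ->] //|x x' y /sub[-> _] /sub[-> _] //|R t u tu].
  have ta m : t m = a by have [] := sub _ _ (tu m).
  have ub m : u m = b by have [] := sub _ _ (tu m).
  apply/idP/idP => inR.
    have [u' [u'R u'b _]] := stab_walk st inR (ta (Ordinal (ar_pos R))).
    have -> // : u = u'.
    by apply/ffunP => m; rewrite (maxar1_ord m (Ordinal (ar_pos R)) ar1) u'b.
  have [t' [t'R t'a _]] := stab_walk (stab_sym st) inR (ub (Ordinal (ar_pos R))).
  have -> // : t = t'.
  by apply/ffunP => m; rewrite (maxar1_ord m (Ordinal (ar_pos R)) ar1) t'a.
- move=> p _; rewrite ltnS leqn0 cards_eq0 => /eqP ->.
  exists f; split=> [|a]; first exact: injections_bij finj ginj.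
  by right; exists a, (f a); rewrite setU0.
Qed.
End ArityOne.

(** * Stable colours of tuples *)

Section StableTuples.
Variables (sg : signature) (k : nat).

Definition tstab (A B : structure sg) (j : 'I_k) (a : {ffun 'I_j.+1 -> univ A})
    (b : {ffun 'I_j.+1 -> univ B}) : Prop :=
  stab (S := star A k) (S' := star B k) (inl (inl (mktup a))) (inl (inl (mktup b))).

Lemma tstab_sym (A B : structure sg) (j : 'I_k) (a : {ffun 'I_j.+1 -> univ A})
    (b : {ffun 'I_j.+1 -> univ B}) : tstab a b -> tstab b a.
Proof. exact: stab_sym. Qed.

Lemma star_walk (A B : structure sg) (x : starU A k) (y : starU B k) (s : starsym sg k)
    (m : 'I_(starar s)) (t : {ffun 'I_(starar s) -> starU A k}) :
  stab (S := star A k) (S' := star B k) (inl x) (inl y) ->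
  t \in starrel A s -> t m = x ->
  exists u : {ffun 'I_(starar s) -> starU B k}, [/\ u \in starrel B s, u m = y &
    forall m', stab (S := star A k) (S' := star B k) (inl (t m')) (inl (u m'))].
Proof. exact: stab_walk. Qed.

Lemma tstab_reidx (A B : structure sg) (j j' : 'I_k) (i : {ffun 'I_j'.+1 -> 'I_j.+1})
    (a : {ffun 'I_j.+1 -> univ A}) (b : {ffun 'I_j.+1 -> univ B}) :
  tstab a b -> tstab (reidx i a) (reidx i b).
Proof.
move=> st.
pose t : {ffun 'I_2 -> starU A k} := pr2 (inl (mktup a)) (inl (mktup (reidx i a))).
have ts : t \in starrel A (projT i).
  by apply/in_projT; exists a; rewrite pr2_0 pr2_1.
have [u [us u0 ut]] := star_walk (s := projT i) (m := ord0) (t := t) st ts (pr2_0 _ _).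
have /in_projT[b' [eb u1]] := us; have {}eb := tup_inj (etrans (esym u0) eb); subst b'.
by have := ut o1; rewrite u1 pr2_1.
Qed.

Lemma tstab_eq (A B : structure sg) (j : 'I_k) (a : {ffun 'I_j.+1 -> univ A})
    (b : {ffun 'I_j.+1 -> univ B}) m m' : tstab a b -> a m = a m' -> b m = b m'.
Proof.
move=> st e.
pose t : {ffun 'I_1 -> starU A k} := [ffun=> inl (mktup a)].
have ts : t \in starrel A (symT [set m; m']).
  apply/in_symT; exists a; rewrite ffunE; split=> // i i'.
  by rewrite !inE => /orP[]/eqP -> /orP[]/eqP ->.
have t0 : t ord0 = inl (mktup a) by rewrite ffunE.
have [u [us u0 _]] := star_walk (s := symT [set m; m']) (m := ord0) (t := t) st ts t0.
have /in_symT[b' [eb H]] := us; have {}eb := tup_inj (etrans (esym u0) eb); subst b'.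
by apply: H; rewrite !inE eqxx ?orbT.
Qed.

(** The tuple is first projected to the list of all entries of the constraint, which has length
    [ar R <= k]; from there the projection [ci] leads back to the constraint. As [ci] omits no
    entry, the constraint found on the side of [B] is the expected one. The casts arise because an
    index [j] encodes length [j.+1]. *)
Lemma tstab_rel (A B : structure sg) (j : 'I_k) (a : {ffun 'I_j.+1 -> univ A})
    (b : {ffun 'I_j.+1 -> univ B}) R (pi : 'I_(ar R) -> 'I_j.+1) :
  ar R <= k -> tstab a b -> reidx pi a \in rels A R -> reidx pi b \in rels B R.
Proof.
move=> Rk st aR.
have eR : (ar R).-1.+1 = ar R by rewrite prednK // ar_pos.
have nk : (ar R).-1 < k by rewrite eR.
pose j' := Ordinal nk.
pose c (m : 'I_j'.+1) : 'I_(ar R) := cast_ord eR m.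
pose i : {ffun 'I_j'.+1 -> 'I_j.+1} := [ffun m => pi (c m)].
pose ci : {ffun 'I_j'.+1 -> 'I_(ar R)} := [ffun m => c m].
have ciE (T : finType) (d : {ffun 'I_j.+1 -> T}) : reidx ci (reidx pi d) = reidx i d.
  by apply/ffunP => m; rewrite !ffunE.
have st' := tstab_reidx i st.
pose t : {ffun 'I_2 -> starU A k} := pr2 (inr (cvert aR)) (inl (mktup (reidx i a))).
have ts : t \in starrel A (projR ci).
  by apply/in_projR; exists (reidx pi a), aR; rewrite pr2_0 pr2_1 ciE.
have [u [us u1 _]] := star_walk (s := projR ci) (m := o1) (t := t) st' ts (pr2_1 _ _).
have /in_projR[b' [bR [_ eb]]] := us; have {}eb := tup_inj (etrans (esym u1) eb).
have -> // : reidx pi b = b'.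
apply/ffunP => m; have /ffunP/(_ (cast_ord (esym eR) m)) := eb.
by rewrite -ciE !ffunE /c cast_ordKV.
Qed.

(** Membership in the symbol for tuples of length one is visible in the colour, so such tuples go to
    such tuples; the index [j0], of value 0, encodes length one. *)
Lemma star_inj (A B : structure sg) : 1 < k -> equiv1 (star A k) (star B k) ->
  exists f : univ A -> univ B, injective f /\
    forall a, exists j : 'I_k, tstab (j := j) [ffun=> a] [ffun=> f a].
Proof.
move=> k1 AB; have [g [ginj gP]] := equiv1_inj AB.
pose j0 := Ordinal (ltnW k1).
have ex a : exists b, g (inl (mktup (j := j0) [ffun=> a])) = inl (mktup (j := j0) [ffun=> b]).
  pose t : {ffun 'I_1 -> starU A k} := [ffun=> inl (mktup (j := j0) [ffun=> a])].
  have ts : t \in starrel A (symT (j := j0) set0).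
    by apply/in_symT; exists [ffun=> a]; rewrite ffunE; split=> // i i'; rewrite inE.
  have t0 : t ord0 = inl (mktup (j := j0) [ffun=> a]) by rewrite ffunE.
  have [u [us u0 _]] := star_walk (s := symT (j := j0) set0) (m := ord0) (t := t) (gP _) ts t0.
  have /in_symT[b [eb _]] := us; exists (b ord0); rewrite -u0 eb.
  by congr (inl (mktup _)); apply/ffunP => m; rewrite ffunE [m]ord1.
have [f fP] := fin_all_exists ex; exists f; split=> [a a' e|a].
  have /ginj : g (inl (mktup (j := j0) [ffun=> a])) = g (inl (mktup (j := j0) [ffun=> a'])).
    by rewrite !fP e.
  by move/tup_inj/ffunP/(_ ord0); rewrite !ffunE.
by exists j0; rewrite /tstab -fP; apply: gP.
Qed.

(* The neighbours of a tuple along the projection that forgets the last entry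
   are its one-point extensions. *)
Lemma tstab_forth (A B : structure sg) (j : 'I_k) (a : {ffun 'I_j.+1 -> univ A})
    (b : {ffun 'I_j.+1 -> univ B}) : j.+1 < k -> tstab a b ->
  exists f : univ A -> univ B, injective f /\ forall c,
    exists (j' : 'I_k) (a' : {ffun 'I_j'.+1 -> univ A}) b',
      tstab a' b' /\ (c, f c) |: gr setT a b \subset gr setT a' b'.
Proof.
move=> jk st; pose j' := Ordinal jk.
pose i : {ffun 'I_j.+1 -> 'I_j'.+1} := [ffun m => widen_ord (leqnSn j.+1) m].
pose ext (C : structure sg) (d : {ffun 'I_j.+1 -> univ C}) c : {ffun 'I_j'.+1 -> univ C} :=
  [ffun m : 'I_j.+2 => if insub (val m) is Some m' then d m' else c].
have ext_i C d c : reidx i (@ext C d c) = d.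
  apply/ffunP => m; rewrite !ffunE /= insubT ?ltn_ord // => lt.
  by congr (d _); apply: val_inj.
have ext_max C d c : @ext C d c ord_max = c by rewrite ffunE insubF //= ltnn.
have ext_eta C d (d' : {ffun 'I_j'.+1 -> univ C}) :
    reidx i d' = d -> d' = @ext C d (d' ord_max).
  move=> e; apply/ffunP => m; rewrite ffunE; case: insubP => [m' lt em|].
    by rewrite -e !ffunE; congr (d' _); apply: val_inj.
  rewrite -leqNgt => le; congr (d' _); apply: val_inj; apply/eqP.
  by rewrite eqn_leq le -ltnS ltn_ord.
have [F [Finj FP]] := stab_nbr st.
pose T (C : structure sg) (d : {ffun 'I_j.+1 -> univ C}) c : {ffun 'I_2 -> starU C k} :=
  pr2 (inl (mktup (@ext C d c))) (inl (mktup d)).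
have Ts C d c : @T C d c \in starrel C (projT i).
  by apply/in_projT; exists (@ext C d c); rewrite pr2_0 pr2_1 ext_i.
have ex c : exists e, F (inr (cvert (S := star A k) (s := projT i) (Ts A a c))) =
      inr (cvert (S := star B k) (s := projT i) (Ts B b e)) /\ tstab (ext A a c) (ext B b e).
  have [u [us [Fu u1 ut]]] := FP (projT i) o1 (T A a c) (Ts A a c) (pr2_1 _ _).
  have /in_projT[b' [u0 u1']] := us.
  have eb := tup_inj (etrans (esym u1) u1').
  exists (b' ord_max); rewrite Fu; have eu : u = T B b (b' ord_max).
    apply/ffunP => m; case: (ord2P m) => ->; rewrite ?pr2_0 ?pr2_1 //.
    by rewrite u0 -(ext_eta _ b b').
  split; first by congr inr; apply: val_inj; rewrite /= eu.
  by have := ut ord0; rewrite /T pr2_0 eu pr2_0.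
have [f fP] := fin_all_exists ex; exists f; split=> [c c' e|c].
  have nb c0 : inr (cvert (S := star A k) (s := projT i) (Ts A a c0)) \in
      nbr (A := star A k) (inl (inl (mktup a))).
    by apply/nbr_elt; exists (projT i), (T A a c0), (Ts A a c0), o1; rewrite pr2_1.
  have /(Finj _ _ (nb c) (nb c'))/fvert_inj/mkc_inj/ffunP/(_ ord0) :
      F (inr (cvert (S := star A k) (s := projT i) (Ts A a c))) =
      F (inr (cvert (S := star A k) (s := projT i) (Ts A a c'))).
    by have [-> _] := fP c; have [-> _] := fP c'; rewrite e.
  by rewrite !pr2_0 => /tup_inj/ffunP/(_ ord_max); rewrite !ext_max.
exists j', (ext A a c), (ext B b (f c)); split; first by have [] := fP c.
rewrite subUset sub1set; apply/andP; split.
  by rewrite -{1}(ext_max A a c) -{1}(ext_max B b (f c)); apply: mem_gr.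
by have := gr_reidx i (ext A a c) (ext B b (f c)); rewrite !ext_i.
Qed.

Lemma star_equiv1_bf (A B : structure sg) : 1 < k -> maxar sg <= k ->
  equiv1 (star A k) (star B k) -> exists P, bf_system k (A := A) (B := B) P.
Proof.
move=> k1 ark AB.
have [f0 [f0inj f0P]] := star_inj k1 AB.
have [g0 [g0inj _]] := star_inj k1 (equiv1_sym AB).
exists (fun p : {set univ A * univ B} => p = set0 \/ exists (j : 'I_k) (a : {ffun 'I_j.+1 -> univ A}) b,
  tstab a b /\ p \subset gr setT a b); split.
- by left.
- move=> p q qp [p0|[j [a [b [st pab]]]]].
    by left; apply/eqP; rewrite -subset0 -p0.
  by right; exists j, a, b; split=> //; apply: subset_trans pab.
- move=> p [->|[j [a [b [st /subsetP pab]]]]].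
    split=> [a b b'|a a' b|R t u tu]; rewrite ?inE //.
    by have := tu (Ordinal (ar_pos R)); rewrite inE.
  have sub x y : (x, y) \in p -> exists m, x = a m /\ y = b m.
    by move=> /pab/imsetP[m _ [-> ->]]; exists m.
  split=> [x y y' /sub[m [-> ->]] /sub[m' [e ->]]|x x' y /sub[m [-> ->]] /sub[m' [-> e]]|R t u tu].
  + exact: tstab_eq st e.
  + exact: tstab_eq (tstab_sym st) e.
  + have [pi piP] := fin_all_exists (fun m => sub _ _ (tu m)).
    have -> : t = reidx pi a by apply/ffunP => m; rewrite ffunE; have [] := piP m.
    have -> : u = reidx pi b by apply/ffunP => m; rewrite ffunE; have [] := piP m.
    have Rk : ar R <= k := leq_trans (leq_bigmax R) ark.
    by apply/idP/idP; apply: tstab_rel => //; apply: tstab_sym.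
- move=> p [->|[j [a [b [st /subsetP pab]]]]] pk.
    exists f0; split=> [|a]; first exact: injections_bij f0inj g0inj.
    right; have [j st] := f0P a; exists j, [ffun=> a], [ffun=> f0 a]; split=> //.
    rewrite setU0 sub1set; apply/imsetP; exists ord0 => //; by rewrite !ffunE.
  (* There are no tuples of length zero, so an empty [p] is treated by [f0] even when it comes with
     a tuple. *)
  have [p0|pn0] := eqVneq p set0.
    exists f0; split=> [|c]; first exact: injections_bij f0inj g0inj.
    right; have [j' st'] := f0P c; exists j', [ffun=> c], [ffun=> f0 c]; split=> //.
    rewrite p0 setU0 sub1set; apply/imsetP; exists ord0 => //; by rewrite !ffunE.
  have [x0 x0p] := set0Pn _ pn0.
  have pS : #|p|.-1.+1 = #|p| by rewrite prednK // (cardD1 x0) x0p.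
  have nk : #|p|.-1 < k by rewrite pS ltnW.
  pose n := Ordinal nk.
  have ex x : exists m : 'I_j.+1, x \in p -> x = (a m, b m).
    have [/pab/imsetP[m _ ->]|_] := boolP (x \in p); by [exists m|exists ord0].
  have [c cP] := fin_all_exists ex.
  (* The tuple covering [p] may already have length [k]. It is replaced by its projection to one
     position per pair of [p], whose length [#|p|] leaves room for one more entry. *)
  pose i : {ffun 'I_n.+1 -> 'I_j.+1} := [ffun m : 'I_n.+1 => c (nth x0 (enum p) m)].
  have jn : n.+1 < k by rewrite /= pS.
  have [f [finj fP]] := tstab_forth jn (tstab_reidx i st).
  exists f; split=> [|d]; first exact: injections_bij finj g0inj.
  right; have [j' [a' [b' [st' sub']]]] := fP d; exists j', a', b'; split=> //.
  apply: subset_trans sub'; apply: setUS; apply/subsetP => x xp.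
  have lt : index x (enum p) < n.+1 by rewrite /= pS cardE index_mem mem_enum.
  apply/imsetP; exists (Ordinal lt) => //.
  by rewrite !ffunE /= nth_index ?mem_enum //; apply: cP.
Qed.
End StableTuples.

Lemma equivk_bf sg k (A B : structure sg) :
  0 < k -> maxar sg <= k ->
  equivk k A B <-> exists P, bf_system k (A := A) (B := B) P.
Proof.
rewrite /equivk; case: eqP => [->|k1] k0 ark.
  split=> [|[P bf]]; first exact: equiv1_bf1.
  apply: half_sim_equiv1 (bf_half_sim1 ark bf) _.
  have := bf_half_sim1 ark (bf_sym bf).
  congr half_sim; apply/funext => b; apply/funext => a /=.
  by rewrite /swap imset_set1.
split=> [|[P bf]]; last exact: bf_star_equiv1 bf.
by apply: star_equiv1_bf => //; case: k k0 k1 {ark} => [|[|]].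
Qed.

Unset Implicit Arguments.

Theorem theorem7p8 (sg : signature) (k : nat) (A B : structure sg) :
  (1 <= k)%N -> (maxar sg <= k)%N ->
  [/\ (equivk k A B <->
         forall X : structure sg, treewidth_lt X k -> nhom X A = nhom X B),
      (equivk k A B <-> Ck_equiv k A B) &
      (equivk k A B <-> dup_wins k A B)].
Proof.
move=> k0 ark; have hub := equivk_bf A B k0 ark.
split; (split=> [/hub[P bf]|H]; last apply/hub).
- exact: bf_nhom bf.
- exact: hom_bf H.
- exact: bf_Ck_equiv bf.
- exact: Ck_equiv_bf H.
- exact: bf_dup_wins bf.
- exact: dup_wins_bf H.
Qed.
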